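(* Let $n\geq 1$ be an integer and $0<s\leq 1$. Let $\gamma:(0,\infty)\to(0,\infty)$ be such that $\gamma(t)$ and $\frac{\gamma(t)}{t}$ are smooth and increasing on $(0,\infty)$, and let $\gamma^{-1}$ be the inverse function of $\gamma$. Let $\{t_k\}_{k=1}^\infty$ be a sequence of positive real numbers converging to $0$ such that $$\sum_{k=1}^{\infty}\frac{1}{\left[\gamma^{-1}\left(\frac{\gamma(1)}{t_k}\right)\right]^{2s}}<\infty.$$ Let $f\in H^s(\mathbb{R}^n)$. Then $$\lim_{k\rightarrow\infty}(2\pi)^{-n}S_{t_k,\gamma}f(x)=f(x)$$ for almost every $x\in\mathbb{R}^n$.
   Context: Fourier transform convention: $\widehat{f}(\xi)=\int_{\mathbb{R}^n}e^{-i\xi\cdot x}f(x)\,dx$. The Sobolev space $H^s(\mathbb{R}^n)$ is the set of tempered distributions $f$ with $\|f\|_{H^s(\mathbb{R}^n)}=\left(\int_{\mathbb{R}^n}(1+|\xi|^2)^s|\widehat f(\xi)|^2\,d\xi\right)^{1/2}<\infty$. For $t\geq0$, $$S_{t,\gamma}f(x)=\int_{\mathbb{R}^n}e^{ix\cdot\xi}e^{it\gamma(|\xi|)}\widehat f(\xi)\,d\xi,\qquad x\in\mathbb{R}^n,$$ where for general $f\in H^s(\mathbb{R}^n)$, $s\ge 0$, the integral is understood in the $L^2$ (Plancherel) sense, i.e. $(2\pi)^{-n}S_{t,\gamma}f$ is the $L^2$ function whose Fourier transform is $e^{it\gamma(|\xi|)}\widehat f(\xi)$ (the value at $\xi=0$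 is immaterial). ''Increasing'' for $\gamma(t)/t$ is in the weak sense (nondecreasing); since $\gamma>0$, $\gamma$ is then a strictly increasing bijection of $(0,\infty)$ onto itself, so $\gamma^{-1}:(0,\infty)\to(0,\infty)$ is well defined. *)

(* Defs.v *)
From HB Require Import structures.
From mathcomp Require Import all_boot all_order all_algebra.
From mathcomp Require Import all_classical all_reals all_analysis.
From mathcomp.real_closed Require Import complex.

Set Implicit Arguments.
Unset Strict Implicit.
Unset Printing Implicit Defensive.

Import Order.TTheory GRing.Theory Num.Theory.
Import numFieldNormedType.Exports.
Import ComplexField.Normc.

Local Open Scope classical_set_scope.
Local Open Scope ring_scope.
Local Open Scope complex_scope.

(* Conventions.  R^n is [n.-tuple R] with the product (Borel) sigma-algebra.
   Complex-valued functions are [n.-tuple R -> R[i]]; [normc : R[i] -> R] is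
   the modulus.  Elements of L^2 and H^s are represented by functions, and the
   operators of L^2 below return some representative of the resulting class. *)

(* The instance of mathcomp-analysis is shadowed by the one for
   subprobabilities and is not found by unification. *)
Lemma product_measure1_sigma_finite d1 d2 (T1 : measurableType d1)
    (T2 : measurableType d2) (R : realType)
    (m1 : {sigma_finite_measure set T1 -> \bar R})
    (m2 : {sigma_finite_measure set T2 -> \bar R}) :
  sigma_finite [set: T1 * T2] (product_measure1 m1 m2).
Proof.
have /sigma_finiteP[F [TF ndF Foo]] := sigma_finiteT m1.
have /sigma_finiteP[G [TG ndG Goo]] := sigma_finiteT m2.
exists (fun k => F k `*` G k).
  rewrite -setXTT TF TG predeqE => -[x y]; split.
    move=> [/= [i _ Fix] [j _ Gjy]]; exists (maxn i j) => //; split.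
    - by move: x Fix; exact/subsetPset/ndF/leq_maxl.
    - by move: y Gjy; exact/subsetPset/ndG/leq_maxr.
  by move=> [i _ []/= ? ?]; split; exists i.
move=> k; have [mF Fk] := Foo k; have [mG Gk] := Goo k.
split; first exact: measurableX.
by rewrite product_measure1E// lte_mul_pinfty// ge0_fin_numE.
Qed.

(* Given a measure on R^n, the product of the Lebesgue measure on R with it,
   transported from R * R^n to R^(n+1). *)
Section lebesgue_cons.
Context {R : realType} {n : nat}.
Variable mu : {sigma_finite_measure set (n.-tuple R) -> \bar R}.

Definition cons_prod (p : measurableTypeR R * n.-tuple R) : n.+1.-tuple R :=
  [tuple of p.1 :: p.2].

Lemma measurable_cons_prod : measurable_fun [set: _] cons_prod.
Proof.
apply: (@measurable_cons _ _ _ R (fun p => p.1) n (fun p => p.2)).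
- exact: measurable_fst.
- exact: measurable_snd.
Qed.

Definition lebesgue_cons : set (n.+1.-tuple R) -> \bar R :=
  pushforward (product_measure1 lebesgue_measure mu) cons_prod.

Let lebesgue_cons0 : lebesgue_cons set0 = 0%E.
Proof. by rewrite /lebesgue_cons /pushforward preimage_set0 measure0. Qed.

Let lebesgue_cons_ge0 A : (0 <= lebesgue_cons A)%E.
Proof. by rewrite /lebesgue_cons /pushforward; exact: measure_ge0. Qed.

Let lebesgue_cons_sigma_additive : semi_sigma_additive lebesgue_cons.
Proof.
move=> F mF tF mUF; rewrite /lebesgue_cons /pushforward preimage_bigcup.
apply: measure_semi_sigma_additive.
- by move=> k; rewrite -[X in measurable X]setTI; exact: measurable_cons_prod.
- apply/trivIsetP => /= i j _ _ ij; rewrite -preimage_setI.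
  by move/trivIsetP : tF => /(_ _ _ _ _ ij) ->//; rewrite preimage_set0.
- rewrite -preimage_bigcup -[X in measurable X]setTI.
  exact: measurable_cons_prod.
Qed.

HB.instance Definition _ := isMeasure.Build _ _ _ lebesgue_cons
  lebesgue_cons0 lebesgue_cons_ge0 lebesgue_cons_sigma_additive.

Let lebesgue_cons_sigma_finite : sigma_finite setT lebesgue_cons.
Proof.
have [F FT mF] := product_measure1_sigma_finite (@lebesgue_measure R) mu.
pose g (x : n.+1.-tuple R) : measurableTypeR R * n.-tuple R :=
  (thead x, [tuple of behead x]).
have mg : measurable_fun [set: _] g.
  apply/measurable_fun_pairP; split => /=.
    exact: (@measurable_tnth _ R n.+1 ord0).
  exact: measurable_behead.
exists (fun k => g @^-1` F k).
  by rewrite -preimage_bigcup -FT preimage_setT.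
move=> k; have [mFk Fkoo] := mF k; split.
  by rewrite -[X in measurable X]setTI; exact: mg.
rewrite /lebesgue_cons /pushforward -comp_preimage.
rewrite (_ : g \o cons_prod = id) ?preimage_id//.
apply/funext => -[a b] /=; rewrite /g /cons_prod /= theadE; congr pair.
exact: val_inj.
Qed.

HB.instance Definition _ := Measure_isSigmaFinite.Build _ _ _ lebesgue_cons
  lebesgue_cons_sigma_finite.

End lebesgue_cons.

Fixpoint lebesgue (R : realType) (n : nat) :
    {sigma_finite_measure set (n.-tuple R) -> \bar R} :=
  match n with
  | 0 => [the {sigma_finite_measure set (0.-tuple R) -> \bar R}
           of dirac [tuple]]
  | n'.+1 => [the {sigma_finite_measure set (n'.+1.-tuple R) -> \bar R}
               of lebesgue_cons (lebesgue R n')]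
  end.

Section euclidean_space.
Context {R : realType} {n : nat}.
Implicit Types (x xi : n.-tuple R) (f g u : n.-tuple R -> R[i]).

Definition dot x xi : R := \sum_(i < n) tnth x i * tnth xi i.

Definition enorm x : R := Num.sqrt (dot x x).

Definition cis (theta : R) : R[i] := cos theta +i* sin theta.

Definition cmeasurable_fun f :=
  measurable_fun [set: n.-tuple R] (fun x => complex.Re (f x)) /\
  measurable_fun [set: n.-tuple R] (fun x => complex.Im (f x)).

Definition cLnorm (p : \bar R) f : \bar R :=
  Lnorm (lebesgue R n) p (fun x => (normc (f x))%:E).

Definition cLfun (p : \bar R) f := cmeasurable_fun f /\ (cLnorm p f < +oo)%E.

Definition cintegral f : R[i] :=
  (\int[lebesgue R n]_x complex.Re (f x)) +i*
  (\int[lebesgue R n]_x complex.Im (f x)).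

Definition fourier1 f xi : R[i] :=
  cintegral (fun x => cis (- dot xi x) * f x).

(* [g] represents the Plancherel transform of [f]: the extension by density
   and continuity of [fourier1] from the intersection of L^1 and L^2 to L^2. *)
Definition is_fourier f g :=
  [/\ cLfun 2%:E f, cLfun 2%:E g &
    exists h : nat -> n.-tuple R -> R[i],
      [/\ forall k, cLfun 1%:E (h k) /\ cLfun 2%:E (h k),
          cLnorm 2%:E (fun x => h k x - f x) @[k --> \oo] --> 0%E &
          cLnorm 2%:E (fun xi => fourier1 (h k) xi - g xi) @[k --> \oo]
            --> 0%E]].

(* Plancherel's theorem makes both sets nonempty for functions in L^2, with
   elements that are equal almost everywhere. *)
Definition fourier f : n.-tuple R -> R[i] :=
  xget (fun=> 0) [set g | is_fourier f g].

Definition inverse_fourier g : n.-tuple R -> R[i] :=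
  xget (fun=> 0) [set f | is_fourier f g].

(* For s >= 0, where H^s is a subspace of L^2. *)
Definition sobolev (s : R) f :=
  cLfun 2%:E f /\
  (\int[lebesgue R n]_xi
     ((1 + enorm xi ^+ 2) `^ s * normc (fourier f xi) ^+ 2)%:E < +oo)%E.

(* The factor (2 pi)^n comes from the absence of a normalizing constant in the
   integral defining S_{t,gamma}. *)
Definition S_op (t : R) (gamma : R -> R) f x : R[i] :=
  ((2 * pi) ^+ n)%:C *
  inverse_fourier (fun xi => cis (t * gamma (enorm xi)) * fourier f xi) x.

End euclidean_space.

Definition smooth_pos {R : realType} (g : R -> R) :=
  forall (m : nat) (x : R), 0 < x -> derivable (derive1n m g) x 1.

Definition increasing_pos {R : realType} (g : R -> R) :=
  forall x y : R, 0 < x -> x <= y -> g x <= g y.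

(* The inverse of a bijection of (0, +oo) onto itself. *)
Definition inverse_pos {R : realType} (g : R -> R) : R -> R :=
  'pinv_(fun=> 0) [set x : R | 0 < x] g.

(* Main.v *)
(* Let f_k be (2 pi)^-n S_{t_k} f and r_k := gamma^-1(gamma(1) / t_k). Since
   gamma(r) / r is nondecreasing, t_k gamma(r) <= gamma(1) r / r_k for r <= r_k,
   so that |exp(i t_k gamma(r)) - 1|^2 <= C (r / r_k)^(2s) for all r > 0, using
   s <= 1 below r_k and the trivial bound 4 above it. By Plancherel,
   |f_k - f|_2^2 is at most a multiple of r_k^(-2s) |f|_{H^s}^2; hence
   sum_k |f_k - f|_2^2 < oo, and sum_k |f_k(x) - f(x)|^2 < oo for almost every x.

   Plancherel's theorem on the line: the integral of exp(-e|xi|) |h^(xi)|^2 is a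
   double integral of h(x) conj(h(y)) against a Poisson kernel, and AM-GM gives
   |h^|^2 <= 2 pi |h|^2. The defect 2 pi |h|^2 - |h^|^2 is a nonnegative quadratic
   form; it vanishes on indicators of intervals, by a lower bound on the same
   double integral, hence on a closed subspace containing them, which is everything
   by a Dynkin-class argument. Higher dimensions follow by Tonelli, one coordinate
   at a time. *)
Require Import Defs.
From mathcomp Require Import all_boot all_order all_algebra.
From mathcomp Require Import all_classical all_reals all_analysis.
From mathcomp.real_closed Require Import complex.
From mathcomp Require Import measurable_realfun ring lra.
Set Implicit Arguments.
Unset Strict Implicit.
Unset Printing Implicit Defensive.

Import Order.TTheory GRing.Theory Num.Theory.
Import numFieldNormedType.Exports.
Local Open Scope classical_set_scope.
Local Open Scope ring_scope.
Local Open Scope complex_scope.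

(** [fourier] and [inverse_fourier] choose from sets and fall back on 0 when these are empty. The
    transform must therefore be constructed on all of L^2 and shown to be onto before any norm can
    be compared. Existence follows from Plancherel and completeness. Surjectivity starts from an
    explicit candidate for the preimage, the cross term of the expanded square being computed by the
    multiplication formula. The weight exp(-e|xi|) is there because |h^|^2 is not known to be
    integrable at that stage, so that Fubini cannot be applied to it directly. The inequality on L^1
    and L^2 has to precede the equality: it is what makes the defect nonnegative. Equality is then
    computed only on intervals, where the double integral has a nonnegative integrand and can be
    bounded below by restricting it. Norms stay squared throughout, in agreement with the exponent
    2s of the hypothesis. Sums then cost factors 2, 4 or 16 in place of a triangle inequality; they
    are harmless, as only the finiteness of the last series matters. *)

Notation cre := complex.Re.
Notation cim := complex.Im.
Notation normc := ComplexField.Normc.normc.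

(** * Complex numbers and the squared modulus *)

Section complex_numbers.
Context {R : realType}.
Implicit Types (z w : R[i]) (a : R).

(** A polynomial in the two parts: identities fall to [ring], and square roots stay out of the
    estimates. *)
Definition sqn z : R := cre z ^+ 2 + cim z ^+ 2.

Lemma creD z w : cre (z + w) = cre z + cre w. Proof. by case: z w => [? ?] []. Qed.
Lemma cimD z w : cim (z + w) = cim z + cim w. Proof. by case: z w => [? ?] []. Qed.
Lemma creN z : cre (- z) = - cre z. Proof. by case: z. Qed.
Lemma cimN z : cim (- z) = - cim z. Proof. by case: z. Qed.
Lemma creB z w : cre (z - w) = cre z - cre w. Proof. by rewrite creD creN. Qed.
Lemma cimB z w : cim (z - w) = cim z - cim w. Proof. by rewrite cimD cimN. Qed.
Lemma creM z w : cre (z * w) = cre z * cre w - cim z * cim w.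
Proof. by case: z w => [? ?] []. Qed.
Lemma cimM z w : cim (z * w) = cre z * cim w + cim z * cre w.
Proof. by case: z w => [? ?] []. Qed.
Lemma creJ z : cre z^*%C = cre z. Proof. by case: z. Qed.
Lemma cimJ z : cim z^*%C = - cim z. Proof. by case: z. Qed.
Definition ReIm := (creB, cimB, creD, cimD, creN, cimN, creM, cimM, creJ, cimJ).

Lemma complex_ext z w : cre z = cre w -> cim z = cim w -> z = w.
Proof. by case: z w => [? ?] [? ?] /= -> ->. Qed.

Lemma conjcMr z w : (z * w)^*%C = z^*%C * w^*%C.
Proof. by apply: complex_ext; rewrite !ReIm; ring. Qed.

Lemma normc_sqr z : normc z ^+ 2 = sqn z.
Proof. by case: z => a b; rewrite /sqn /= sqr_sqrtr// addr_ge0// sqr_ge0. Qed.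

Lemma normc_sqrt z : normc z = Num.sqrt (sqn z).
Proof. by case: z. Qed.

Lemma normc_ge0 z : 0 <= normc z.
Proof. by rewrite normc_sqrt sqrtr_ge0. Qed.

Lemma sqn_ge0 z : 0 <= sqn z. Proof. by rewrite addr_ge0// sqr_ge0. Qed.
Lemma sqnM z w : sqn (z * w) = sqn z * sqn w.
Proof. by rewrite /sqn !ReIm; ring. Qed.
Lemma sqnN z : sqn (- z) = sqn z. Proof. by rewrite /sqn !ReIm; ring. Qed.
Lemma sqn_distC z w : sqn (z - w) = sqn (w - z). Proof. by rewrite -opprB sqnN. Qed.
Lemma sqnJ z : sqn z^*%C = sqn z. Proof. by rewrite /sqn !ReIm; ring. Qed.
Lemma sqn_real a : sqn a%:C = a ^+ 2. Proof. by rewrite /sqn /=; ring. Qed.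
Lemma sqn0 : sqn (0 : R[i]) = 0. Proof. by rewrite /sqn /=; ring. Qed.

Lemma sqnD_le z w : sqn (z + w) <= 2 * sqn z + 2 * sqn w.
Proof.
rewrite -subr_ge0 (_ : _ - _ = sqn (z - w)) ?sqn_ge0//.
by rewrite /sqn !ReIm; ring.
Qed.

Lemma sqn_parallelogram z w :
  sqn (z + w) + sqn (z - w) = 2 * sqn z + 2 * sqn w.
Proof. by rewrite /sqn !ReIm; ring. Qed.

Lemma sqnB_expand z w : sqn (z - w) = sqn z - 2 * cre (z * w^*%C) + sqn w.
Proof. by rewrite /sqn !ReIm; ring. Qed.

Lemma normr_Re_le z : `|cre z| <= normc z.
Proof.
rewrite normc_sqrt -sqrtr_sqr ler_sqrt ?sqn_ge0//.
by rewrite /sqn lerDl sqr_ge0.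
Qed.

Lemma normr_Im_le z : `|cim z| <= normc z.
Proof.
rewrite normc_sqrt -sqrtr_sqr ler_sqrt ?sqn_ge0//.
by rewrite /sqn lerDr sqr_ge0.
Qed.

Lemma normc_le_ReIm z : normc z <= `|cre z| + `|cim z|.
Proof.
rewrite normc_sqrt -[leRHS]ger0_norm ?addr_ge0//.
rewrite -sqrtr_sqr ler_sqrt ?sqr_ge0//.
rewrite sqrrD /sqn !real_normK ?num_real// lerD2r lerDl.
by rewrite mulrn_wge0// mulr_ge0.
Qed.

Lemma normcM z w : normc (z * w) = normc z * normc w.
Proof. by rewrite !normc_sqrt sqnM sqrtrM ?sqn_ge0. Qed.

Lemma normcM_le z w : normc (z * w) <= sqn z + sqn w.
Proof.
rewrite normcM -!normc_sqr.
have := sqr_ge0 (normc z - normc w); have := sqr_ge0 (normc z + normc w); nra.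
Qed.

Lemma sqn_cis a : sqn (cis a) = 1.
Proof. by rewrite /sqn /cis /= cos2Dsin2. Qed.

Lemma normc_cis a : normc (cis a) = 1.
Proof. by rewrite normc_sqrt sqn_cis sqrtr1. Qed.

Lemma cisD a (b : R) : cis (a + b) = cis a * cis b.
Proof.
by apply: complex_ext; rewrite ReIm /= ?cosD ?sinD//; ring.
Qed.

Lemma cisN a : cis (- a) = (cis a)^*%C.
Proof. by apply: complex_ext; rewrite /= ?cosN ?sinN. Qed.

End complex_numbers.

(** * Complex-valued functions on an abstract measure space *)

Section complex_integration.
Context {d} {T : measurableType d} {R : realType}.
Implicit Types (f g h : T -> R[i]).

(** [cmeasurable_fun] on an arbitrary space, since products and their sections occur below. *)
Definition cmeas f :=
  measurable_fun [set: T] (fun x => cre (f x)) /\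
  measurable_fun [set: T] (fun x => cim (f x)).

Lemma cmeas_comp {d'} {T' : measurableType d'} f (phi : T' -> T) : cmeas f ->
  measurable_fun setT phi ->
  measurable_fun [set: T'] (fun x => cre (f (phi x))) /\
  measurable_fun [set: T'] (fun x => cim (f (phi x))).
Proof.
move=> [mr mi] mphi; split.
  exact: (measurableT_comp mr mphi).
exact: (measurableT_comp mi mphi).
Qed.

Lemma cmeasD f g : cmeas f -> cmeas g -> cmeas (fun x => f x + g x).
Proof.
move=> [fr fi] [gr gi]; split.
  by under eq_fun do rewrite creD; exact: measurable_funD.
by under eq_fun do rewrite cimD; exact: measurable_funD.
Qed.

Lemma cmeasB f g : cmeas f -> cmeas g -> cmeas (fun x => f x - g x).
Proof.
move=> [fr fi] [gr gi]; split.
  by under eq_fun do rewrite creB; exact: measurable_funB.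
by under eq_fun do rewrite cimB; exact: measurable_funB.
Qed.

Lemma cmeasM f g : cmeas f -> cmeas g -> cmeas (fun x => f x * g x).
Proof.
move=> [fr fi] [gr gi]; split.
  by under eq_fun do rewrite creM; apply: measurable_funB; exact: measurable_funM.
by under eq_fun do rewrite cimM; apply: measurable_funD; exact: measurable_funM.
Qed.

Lemma cmeasJ f : cmeas f -> cmeas (fun x => (f x)^*%C).
Proof.
move=> [fr fi]; split.
  by under eq_fun do rewrite creJ.
by under eq_fun do rewrite cimJ; exact: measurableT_comp.
Qed.

Lemma cmeas_cst (c : R[i]) : cmeas (cst c).
Proof. by split; exact: measurable_cst. Qed.

Lemma cmeas_real (u : T -> R) : measurable_fun setT u ->
  cmeas (fun x => (u x)%:C).
Proof. by move=> mu; split => //=; exact: measurable_cst. Qed.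

Lemma cmeas_cis (u : T -> R) : measurable_fun setT u ->
  cmeas (fun x => cis (u x)).
Proof.
move=> mu; split => /=.
  apply: (@measurableT_comp _ _ _ _ _ _ (@cos R)) => //.
  by apply: continuous_measurable_fun; exact: continuous_cos.
apply: (@measurableT_comp _ _ _ _ _ _ (@sin R)) => //.
by apply: continuous_measurable_fun; exact: continuous_sin.
Qed.

Lemma measurable_sqn f : cmeas f -> measurable_fun setT (fun x => sqn (f x)).
Proof. by move=> [fr fi]; apply: measurable_funD; exact: measurable_funX. Qed.

Lemma measurable_normc f : cmeas f -> measurable_fun setT (fun x => normc (f x)).
Proof.
move=> /measurable_sqn mf; under eq_fun do rewrite normc_sqrt.
apply: (@measurableT_comp _ _ _ _ _ _ (@Num.sqrt R)) => //.
by apply: nondecreasing_measurable => // a b; exact: ler_wsqrtr.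
Qed.

Variable mu : {measure set T -> \bar R}.

(** Unfolds to [cintegral] when the measure is [lebesgue R n]. *)
Definition cint f : R[i] :=
  (\int[mu]_x cre (f x)) +i* (\int[mu]_x cim (f x)).

Definition L1 f := mu.-integrable setT (fun x => (cre (f x))%:E) /\
  mu.-integrable setT (fun x => (cim (f x))%:E).

(** The squared L^2 norm, extended-real so that it can be manipulated before it is known to be
    finite. *)
Definition N2 f : \bar R := (\int[mu]_x (sqn (f x))%:E)%E.

Definition L2 f := cmeas f /\ (N2 f < +oo)%E.

Lemma L1_cmeas f : L1 f -> cmeas f.
Proof.
by move=> [/measurable_int/measurable_EFinP ? /measurable_int/measurable_EFinP].
Qed.

Lemma L1P f : cmeas f -> L1 f <-> (\int[mu]_x (normc (f x))%:E < +oo)%E.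
Proof.
move=> mf; have mn := measurable_normc mf; split.
  move=> [ir ii].
  have : (\int[mu]_x (`|cre (f x)|%:E + `|cim (f x)|%:E) < +oo)%E.
    rewrite ge0_integralD//=.
    - by rewrite lte_add_pinfty//; [case/integrableP: ir|case/integrableP: ii].
    - apply/measurable_EFinP; apply: measurableT_comp => //.
      by case: mf.
    - by apply/measurable_EFinP; apply: measurableT_comp => //; case: mf.
  apply: le_lt_trans; apply: ge0_le_integral => //=.
  - by move=> x _; rewrite lee_fin normc_ge0.
  - exact/measurable_EFinP.
  - apply/measurable_EFinP; apply: measurable_funD;
      by apply: measurableT_comp => //; case: mf.
  - by move=> x _; rewrite -EFinD lee_fin normc_le_ReIm.
move=> foo; case: mf => mr mi; split; apply/integrableP; split;
  try exact/measurable_EFinP; apply: le_lt_trans foo;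
  apply: ge0_le_integral => //=.
- by apply/measurable_EFinP; apply: measurableT_comp.
- exact/measurable_EFinP.
- by move=> x _; rewrite lee_fin normr_Re_le.
- by apply/measurable_EFinP; apply: measurableT_comp.
- exact/measurable_EFinP.
- by move=> x _; rewrite lee_fin normr_Im_le.
Qed.

Lemma L1_ltoo f : L1 f -> (\int[mu]_x (normc (f x))%:E < +oo)%E.
Proof. by move=> If; apply/L1P => //; exact: L1_cmeas. Qed.

Lemma L1_le (u : T -> R) f : cmeas f -> (forall x, normc (f x) <= u x) ->
  mu.-integrable setT (fun x => (u x)%:E) -> L1 f.
Proof.
move=> mf fu /integrableP[mu' iu]; apply/L1P => //; apply: le_lt_trans iu.
apply: ge0_le_integral => //=.
- by move=> x _; rewrite lee_fin normc_ge0.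
- exact/measurable_EFinP/measurable_normc.
- by apply/measurable_EFinP; apply: measurableT_comp => //; exact/measurable_EFinP.
- by move=> x _; rewrite lee_fin (le_trans (fu x))// ler_norm.
Qed.

Lemma L1_dom f g : cmeas f -> (forall x, normc (f x) <= normc (g x)) -> L1 g -> L1 f.
Proof.
move=> mf fg Ig; apply: (L1_le _ fg) => //; apply/integrableP; split.
  exact/measurable_EFinP/measurable_normc/L1_cmeas.
under eq_integral do rewrite abse_EFin ger0_norm ?normc_ge0//.
exact: L1_ltoo.
Qed.

Lemma L1D f g : L1 f -> L1 g -> L1 (fun x => f x + g x).
Proof.
move=> [fr fi] [gr gi]; split.
  by under eq_fun do rewrite creD EFinD; exact: integrableD.
by under eq_fun do rewrite cimD EFinD; exact: integrableD.
Qed.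

Lemma L1B f g : L1 f -> L1 g -> L1 (fun x => f x - g x).
Proof.
move=> [fr fi] [gr gi]; split.
  by under eq_fun do rewrite creB EFinB; exact: integrableB.
by under eq_fun do rewrite cimB EFinB; exact: integrableB.
Qed.

Lemma L1Zl (c : R[i]) f : L1 f -> L1 (fun x => c * f x).
Proof.
move=> If; have mf := L1_cmeas If; case: If => fr fi.
split.
  under eq_fun do rewrite creM EFinB !EFinM.
  by apply: integrableB => //; exact: integrableZl.
under eq_fun do rewrite cimM EFinD !EFinM.
by apply: integrableD => //; exact: integrableZl.
Qed.

Lemma L1J f : L1 f -> L1 (fun x => (f x)^*%C).
Proof.
move=> [fr fi]; split; first by under eq_fun do rewrite creJ.
by under eq_fun do rewrite cimJ EFinN; exact: integrableN.
Qed.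

Lemma L1_cisM (u : T -> R) f : measurable_fun setT u -> L1 f ->
  L1 (fun x => cis (u x) * f x).
Proof.
move=> mu' If; apply: (@L1_dom _ f) => //.
  by apply: cmeasM; [exact: cmeas_cis|exact: L1_cmeas].
by move=> x; rewrite normcM normc_cis mul1r.
Qed.

Lemma eq_cint f g : f =1 g -> cint f = cint g.
Proof. by move=> /funext ->. Qed.

Lemma cintD f g : L1 f -> L1 g -> cint (fun x => f x + g x) = cint f + cint g.
Proof.
move=> [fr fi] [gr gi]; apply: complex_ext; rewrite ReIm /=.
  by rewrite -RintegralD//; apply: eq_Rintegral => x _; rewrite creD.
by rewrite -RintegralD//; apply: eq_Rintegral => x _; rewrite cimD.
Qed.

Lemma cintB f g : L1 f -> L1 g -> cint (fun x => f x - g x) = cint f - cint g.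
Proof.
move=> [fr fi] [gr gi]; apply: complex_ext; rewrite ReIm /=.
  by rewrite -RintegralB//; apply: eq_Rintegral => x _; rewrite creB.
by rewrite -RintegralB//; apply: eq_Rintegral => x _; rewrite cimB.
Qed.

Lemma cintZl (c : R[i]) f : L1 f -> cint (fun x => c * f x) = c * cint f.
Proof.
move=> [fr fi].
have iZ (a : R) (u : T -> R) : mu.-integrable setT (fun x => (u x)%:E) ->
    mu.-integrable setT (EFin \o (fun x => a * u x)).
  by move=> iu; exact: (integrableZl measurableT a iu).
apply: complex_ext; rewrite ReIm /=.
  rewrite -!RintegralZl// -RintegralB//; [|exact: iZ..].
  by apply: eq_Rintegral => x _; rewrite creM.
rewrite -!RintegralZl// -RintegralD//; [|exact: iZ..].
by apply: eq_Rintegral => x _; rewrite cimM.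
Qed.

Lemma cintJ f : L1 f -> cint (fun x => (f x)^*%C) = (cint f)^*%C.
Proof.
move=> [fr fi]; apply: complex_ext; rewrite ReIm /=.
  by apply: eq_Rintegral => x _; rewrite creJ.
rewrite -mulN1r -RintegralZl//.
by apply: eq_Rintegral => x _; rewrite cimJ mulN1r.
Qed.

Lemma N2_ge0 f : (0 <= N2 f)%E.
Proof. by apply: integral_ge0 => x _; rewrite lee_fin sqn_ge0. Qed.

Lemma eq_N2 f g : (forall x, sqn (f x) = sqn (g x)) -> N2 f = N2 g.
Proof. by move=> fg; apply: eq_integral => x _; rewrite fg. Qed.

Lemma le_N2 f g : cmeas f -> cmeas g -> (forall x, sqn (f x) <= sqn (g x)) ->
  (N2 f <= N2 g)%E.
Proof.
move=> mf mg fg; apply: ge0_le_integral => //.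
- by move=> x _; rewrite lee_fin sqn_ge0.
- exact/measurable_EFinP/measurable_sqn.
- exact/measurable_EFinP/measurable_sqn.
- by move=> x _; rewrite lee_fin fg.
Qed.

Lemma N2Zl (c : R[i]) f : cmeas f -> N2 (fun x => c * f x) = ((sqn c)%:E * N2 f)%E.
Proof.
move=> mf; rewrite /N2 -ge0_integralZl//.
- by apply: eq_integral => x _; rewrite sqnM EFinM.
- exact/measurable_EFinP/measurable_sqn.
- by move=> x _; rewrite lee_fin sqn_ge0.
- by rewrite lee_fin sqn_ge0.
Qed.

Lemma N2_parallelogram f g : cmeas f -> cmeas g ->
  (N2 (fun x => (f x + g x)%R) + N2 (fun x => (f x - g x)%R) =
   2%:E * N2 f + 2%:E * N2 g)%E.
Proof.
move=> mf mg.
have mE h : cmeas h -> measurable_fun setT (fun x => (sqn (h x))%:E).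
  by move=> mh; apply/measurable_EFinP/measurable_sqn.
have n0 h x : setT x -> (0 <= (sqn (h x))%:E)%E by rewrite lee_fin sqn_ge0.
have mA := mE _ (cmeasD mf mg); have mB := mE _ (cmeasB mf mg).
have mF := mE _ mf; have mG := mE _ mg.
have e20 : (0 <= 2%:E :> \bar R)%E by rewrite lee_fin.
have f0 := n0 f; have g0 := n0 g.
rewrite /N2 -(ge0_integralD _ _ _ mA _ mB)//; [|exact: n0..].
rewrite -!ge0_integralZl// -ge0_integralD//.
- by apply: eq_integral => x _; rewrite -!EFinM -!EFinD sqn_parallelogram.
- by move=> x _; rewrite -EFinM lee_fin mulr_ge0// sqn_ge0.
- by apply: emeasurable_funM.
- by move=> x _; rewrite -EFinM lee_fin mulr_ge0// sqn_ge0.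
- by apply: emeasurable_funM.
Qed.

Lemma N2D_le f g : cmeas f -> cmeas g ->
  (N2 (fun x => (f x + g x)%R) <= 2%:E * N2 f + 2%:E * N2 g)%E.
Proof.
by move=> mf mg; rewrite -N2_parallelogram// leeDl// N2_ge0.
Qed.

Lemma N2B_le f g h : cmeas f -> cmeas g -> cmeas h ->
  (N2 (fun x => (f x - h x)%R) <= 2%:E * N2 (fun x => (f x - g x)%R) +
     2%:E * N2 (fun x => (g x - h x)%R))%E.
Proof.
move=> mf mg mh; apply: le_trans (N2D_le (cmeasB mf mg) (cmeasB mg mh)).
by rewrite (@eq_N2 _ (fun x => f x - g x + (g x - h x)))// => x; rewrite subrKA.
Qed.

Lemma N2_distC f g : N2 (fun x => f x - g x) = N2 (fun x => g x - f x).
Proof. by apply: eq_N2 => x; rewrite sqn_distC. Qed.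

Lemma L2_sqn f : L2 f -> mu.-integrable setT (fun x => (sqn (f x))%:E).
Proof.
move=> [mf f2]; apply/integrableP; split.
  exact/measurable_EFinP/measurable_sqn.
by under eq_integral do rewrite abse_EFin ger0_norm ?sqn_ge0//.
Qed.

Lemma N2_fin f : L2 f -> N2 f \is a fin_num.
Proof. by move=> [_ f2]; rewrite ge0_fin_numE// N2_ge0. Qed.

Lemma L2D f g : L2 f -> L2 g -> L2 (fun x => f x + g x).
Proof.
move=> [mf f2] [mg g2]; split; first exact: cmeasD.
apply: le_lt_trans (N2D_le mf mg) _.
by rewrite lte_add_pinfty// lte_mul_pinfty.
Qed.

Lemma L2Zl (c : R[i]) f : L2 f -> L2 (fun x => c * f x).
Proof.
move=> [mf f2]; split; first by apply: cmeasM => //; exact: cmeas_cst.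
by rewrite N2Zl// lte_mul_pinfty// lee_fin sqn_ge0.
Qed.

Lemma L2B f g : L2 f -> L2 g -> L2 (fun x => f x - g x).
Proof.
move=> If Ig; have := L2D If (L2Zl (-1) Ig).
by under eq_fun do rewrite mulN1r.
Qed.

Lemma L2J f : L2 f -> L2 (fun x => (f x)^*%C).
Proof.
move=> [mf f2]; split; first exact: cmeasJ.
by rewrite (@eq_N2 _ f)// => x; rewrite sqnJ.
Qed.

Lemma L2M_L1 f g : L2 f -> L2 g -> L1 (fun x => f x * g x).
Proof.
move=> If Ig; apply: (@L1_le (fun x => sqn (f x) + sqn (g x))).
- by apply: cmeasM; [case: If|case: Ig].
- by move=> x; exact: normcM_le.
- under eq_fun do rewrite EFinD.
  by apply: integrableD => //; exact: L2_sqn.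
Qed.

Lemma N2B_expand f g : L2 f -> L2 g ->
  N2 (fun x => f x - g x) =
  (fine (N2 f) - 2 * cre (cint (fun x => f x * (g x)^*%C)) + fine (N2 g))%:E.
Proof.
move=> If Ig; have [Ifg _] := L2M_L1 If (L2J Ig).
have iF := L2_sqn If; have iG := L2_sqn Ig.
have -> : (fine (N2 f) - 2 * cre (cint (fun x => f x * (g x)^*%C)) +
    fine (N2 g))%:E = (N2 f - 2%:E * (\int[mu]_x (cre (f x * (g x)^*%C))%:E) + N2 g)%E.
  rewrite -(fineK (N2_fin If)) -(fineK (N2_fin Ig)) -(fineK (integrable_fin_num _ Ifg))//.
have iZ : mu.-integrable setT (fun x => 2%:E * (cre (f x * (g x)^*%C))%:E)%E.
  exact: integrableZl.
rewrite -integralZl// -integralB// -integralD//; last exact: integrableB.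
by apply: eq_integral => x _; rewrite sqnB_expand !EFinD EFinN EFinM.
Qed.

End complex_integration.

(** * Parametric integrals and Fubini for complex functions *)

Section measurable_parametric_integral.
Context {d1 d2} {T1 : measurableType d1} {T2 : measurableType d2} {R : realType}.
Variable m2 : {sigma_finite_measure set T2 -> \bar R}.

(** Tonelli makes the integrals of the positive and negative parts measurable in x, and [fine] keeps
    this even where they are infinite. *)
Lemma measurable_Rintegral (f : T1 * T2 -> R) : measurable_fun setT f ->
  measurable_fun setT (fun x => \int[m2]_y f (x, y)).
Proof.
move=> mf; have mf' : measurable_fun setT (EFin \o f) by exact/measurable_EFinP.
rewrite /Rintegral; apply: (@measurableT_comp _ _ _ _ _ _ (@fine R)) => //.
rewrite (_ : (fun x => _) = (fubini_F m2 ((EFin \o f)^\+) \-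
    fubini_F m2 ((EFin \o f)^\-))%E); last first.
  apply/funext => x; rewrite [LHS]integralE /fubini_F /=.
  by congr (_ - _)%E; apply: eq_integral => y _; rewrite ?funeposE ?funenegE.
apply: emeasurable_funB; apply: measurable_fun_fubini_tonelli_F => //.
  exact: measurable_funepos.
exact: measurable_funeneg.
Qed.

Lemma cmeas_cint (H : T1 * T2 -> R[i]) : cmeas H ->
  cmeas (fun x => cint m2 (fun y => H (x, y))).
Proof.
move=> [mr mi]; split.
  exact: (@measurable_Rintegral (fun z => cre (H z))).
exact: (@measurable_Rintegral (fun z => cim (H z))).
Qed.

End measurable_parametric_integral.

Section complex_fubini.
Context {d1 d2} {T1 : measurableType d1} {T2 : measurableType d2} {R : realType}.
Variable m1 : {sigma_finite_measure set T1 -> \bar R}.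
Variable m2 : {sigma_finite_measure set T2 -> \bar R}.

(** [fine] sends an infinite section integral to 0, but integrability of [fubini_F] confines this to
    a null set, which the outer integral ignores. *)
Let Rfubini12 (f : T1 * T2 -> R) : (m1 \x m2)%E.-integrable setT (EFin \o f) ->
  m1.-integrable setT (fun x => (\int[m2]_y f (x, y))%:E) /\
  \int[m1]_x (\int[m2]_y f (x, y)) = \int[(m1 \x m2)%E]_z f z.
Proof.
move=> If.
have IF : m1.-integrable setT (fubini_F m2 (EFin \o f)) := integrable_fubini_F If.
have mG : measurable_fun setT (fun x => (\int[m2]_y f (x, y))%:E).
  apply/measurable_EFinP/measurable_Rintegral.
  by apply/measurable_EFinP; exact: measurable_int If.
have ae : ae_eq m1 setT (fubini_F m2 (EFin \o f)) (fun x => (\int[m2]_y f (x, y))%:E).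
  have := integrable_ae measurableT IF; apply: filterS => x /= /(_ I) fx _.
  by rewrite /Rintegral fineK.
split.
  apply: (le_integrable measurableT mG) IF => x _ /=.
  rewrite /Rintegral /fubini_F /=.
  by case: integral => [r||] //=; rewrite normr0 ?leey ?lee_fin.
have mF := measurable_int _ IF.
by rewrite {1}/Rintegral -(ae_eq_integral _ _ measurableT mF mG ae)
  integral12_prod_meas1.
Qed.

Let Rfubini21 (f : T1 * T2 -> R) : (m1 \x m2)%E.-integrable setT (EFin \o f) ->
  m2.-integrable setT (fun y => (\int[m1]_x f (x, y))%:E) /\
  \int[m2]_y (\int[m1]_x f (x, y)) = \int[(m1 \x m2)%E]_z f z.
Proof.
move=> If.
have mf : measurable_fun setT f.
  by apply/measurable_EFinP; exact: measurable_int If.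
have mG : measurable_fun setT (fun y => \int[m1]_x f (x, y)).
  apply: (@measurable_Rintegral _ _ _ _ _ m1 (fun p => f (p.2, p.1))).
  apply: (measurableT_comp mf).
  by apply: measurable_fun_pair; [exact: measurable_snd|exact: measurable_fst].
have mf' : measurable_fun setT (EFin \o f) by exact/measurable_EFinP.
have IF : m2.-integrable setT (fubini_G m1 (EFin \o f)).
  apply/integrableP; split; first exact: measurable_fubini_G If.
  apply: le_lt_trans ((integrable21ltyP m1 m2 mf').1 If).
  apply: ge0_le_integral => //=.
  - by apply: measurableT_comp => //; exact: measurable_fubini_G If.
  - apply: (measurable_fun_fubini_tonelli_G (abse \o (EFin \o f))).
      exact: measurableT_comp.
    by move=> z; exact: abse_ge0.
  - move=> y _; apply: le_abse_integral => //.
    exact: measurableT_comp.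
have {}mG : measurable_fun setT (fun y => (\int[m1]_x f (x, y))%:E).
  exact/measurable_EFinP.
have ae : ae_eq m2 setT (fubini_G m1 (EFin \o f)) (fun y => (\int[m1]_x f (x, y))%:E).
  have := integrable_ae measurableT IF; apply: filterS => x /= /(_ I) fx _.
  by rewrite /Rintegral fineK.
split.
  apply: (le_integrable measurableT mG) IF => x _ /=.
  rewrite /Rintegral /fubini_G /=.
  by case: integral => [r||] //=; rewrite normr0 ?leey ?lee_fin.
have mF := measurable_int _ IF.
by rewrite {1}/Rintegral -(ae_eq_integral _ _ measurableT mF mG ae)
  integral21_prod_meas1.
Qed.

Lemma cint_fubini (H : T1 * T2 -> R[i]) : cmeas H ->
  (\int[m1]_x \int[m2]_y (normc (H (x, y)))%:E < +oo)%E ->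
  [/\ L1 (m1 \x m2)%E H,
     L1 m1 (fun x => cint m2 (fun y => H (x, y))),
     cint m1 (fun x => cint m2 (fun y => H (x, y))) = cint (m1 \x m2)%E H &
     L1 m2 (fun y => cint m1 (fun x => H (x, y))) /\
     cint m2 (fun y => cint m1 (fun x => H (x, y))) = cint (m1 \x m2)%E H].
Proof.
move=> mH HI.
have [[ir ii]] : L1 (m1 \x m2)%E H /\ True.
  split=> //; apply/L1P => //; rewrite fubini_tonelli1//=.
    exact/measurable_EFinP/measurable_normc.
  by move=> z; rewrite lee_fin normc_ge0.
move=> _.
have [r1 r2] := Rfubini12 ir; have [i1 i2] := Rfubini12 ii.
have [s1 s2] := Rfubini21 ir; have [j1 j2] := Rfubini21 ii.
by split => //; [apply: complex_ext|split => //; apply: complex_ext].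
Qed.

End complex_fubini.

Lemma ae_eq_cint {d} {T : measurableType d} {R : realType}
    (mu : {measure set T -> \bar R}) (f g : T -> R[i]) :
  cmeas f -> cmeas g -> {ae mu, forall x, f x = g x} -> cint mu f = cint mu g.
Proof.
move=> [fr fi] [gr gi] fg; apply: complex_ext; rewrite /= /Rintegral.
  congr fine; apply: ae_eq_integral => //; try exact/measurable_EFinP.
  by apply: filterS fg => x -> _.
congr fine; apply: ae_eq_integral => //; try exact/measurable_EFinP.
by apply: filterS fg => x -> _.
Qed.

(** The factor 2 comes from bounding the two parts separately; the lemma only serves to show that
    transforms of L^1 functions are bounded. *)
Lemma normc_cint_le {d} {T : measurableType d} {R : realType}
    (mu : {measure set T -> \bar R}) (f : T -> R[i]) : L1 mu f ->
  normc (cint mu f) <= 2 * \int[mu]_x normc (f x).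
Proof.
move=> If; have In : mu.-integrable setT (EFin \o (fun x => normc (f x))).
  apply/integrableP; split; first exact/measurable_EFinP/measurable_normc/L1_cmeas/If.
  under eq_integral do rewrite abse_EFin ger0_norm ?normc_ge0//.
  exact: L1_ltoo.
have [ir ii] := If.
rewrite (le_trans (normc_le_ReIm _))// mulr2n mulrDl mul1r lerD//.
  rewrite (le_trans (le_normr_Rintegral measurableT ir))//.
  apply: le_Rintegral => //; first exact: (integrable_norm ir).
  by move=> x _; exact: normr_Re_le.
rewrite (le_trans (le_normr_Rintegral measurableT ii))//.
apply: le_Rintegral => //; first exact: (integrable_norm ii).
by move=> x _; exact: normr_Im_le.
Qed.

(** * Integral transforms with an abstract phase *)

Section generalized_fourier.
Context {d1 d2} {T1 : measurableType d1} {T2 : measurableType d2} {R : realType}.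
Variable m1 : {sigma_finite_measure set T1 -> \bar R}.
Variable p : T1 -> T2 -> R.

(** The phase is a parameter so that the same facts serve the product on the line, its opposite,
    transposed phases and [dot]. *)
Definition ft (h : T1 -> R[i]) (xi : T2) : R[i] :=
  cint m1 (fun x => cis (- p x xi) * h x).

Hypothesis mp : measurable_fun setT (fun z : T1 * T2 => p z.1 z.2).

Lemma measurable_phase xi : measurable_fun setT (fun x => - p x xi).
Proof.
apply: measurable_funN.
exact: (measurableT_comp mp
  (measurable_fun_pair (@measurable_id _ _ _) (@measurable_cst _ _ _ _ _ xi))).
Qed.

Lemma L1_ft h xi : L1 m1 h -> L1 m1 (fun x => cis (- p x xi) * h x).
Proof. by apply: L1_cisM; exact: measurable_phase. Qed.

Lemma cmeas_ft h : cmeas h -> cmeas (ft h).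
Proof.
move=> mh.
apply: (@cmeas_cint _ _ _ _ _ m1 (fun z => cis (- p z.2 z.1) * h z.2)).
apply: cmeasM.
  apply: cmeas_cis; apply: measurable_funN.
  exact: (measurableT_comp mp (measurable_fun_pair
    (@measurable_snd _ _ T2 T1) (@measurable_fst _ _ T2 T1))).
exact: (cmeas_comp mh (@measurable_snd _ _ _ _)).
Qed.

Lemma ftD g h : L1 m1 g -> L1 m1 h ->
  ft (fun x => g x + h x) = fun xi => ft g xi + ft h xi.
Proof.
move=> Ig Ih; apply/funext => xi; rewrite /ft -cintD; [|exact: L1_ft..].
by apply: eq_cint => x; rewrite mulrDr.
Qed.

Lemma ftB g h : L1 m1 g -> L1 m1 h ->
  ft (fun x => g x - h x) = fun xi => ft g xi - ft h xi.
Proof.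
move=> Ig Ih; apply/funext => xi; rewrite /ft -cintB; [|exact: L1_ft..].
by apply: eq_cint => x; rewrite mulrBr.
Qed.

Lemma ftZl c h : L1 m1 h -> ft (fun x => c * h x) = fun xi => c * ft h xi.
Proof.
move=> Ih; apply/funext => xi; rewrite /ft -cintZl; last exact: L1_ft.
by apply: eq_cint => x; rewrite mulrCA.
Qed.

Lemma normc_ft_le h xi : L1 m1 h -> normc (ft h xi) <= 2 * \int[m1]_x normc (h x).
Proof.
move=> Ih; rewrite (le_trans (normc_cint_le (L1_ft xi Ih)))// ler_wpM2l//.
by rewrite le_eqVlt; apply/orP; left; apply/eqP; apply: eq_Rintegral => x _;
  rewrite normcM normc_cis mul1r.
Qed.

End generalized_fourier.

Section multiplication_formula.
Context {d1 d2} {T1 : measurableType d1} {T2 : measurableType d2} {R : realType}.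
Variable m1 : {sigma_finite_measure set T1 -> \bar R}.
Variable m2 : {sigma_finite_measure set T2 -> \bar R}.
Variable p : T1 -> T2 -> R.
Hypothesis mp : measurable_fun setT (fun z : T1 * T2 => p z.1 z.2).

(** Both sides are iterated integrals of cis(- p x y) u(x) v(y), whose modulus |u(x)| |v(y)| has a
    finite double integral. *)
Lemma ft_multiplication u v : L1 m1 u -> L1 m2 v ->
  cint m2 (fun y => ft m1 p u y * v y) =
  cint m1 (fun x => u x * ft m2 (fun y x => p x y) v x).
Proof.
move=> Iu Iv; have mu := L1_cmeas Iu; have mv := L1_cmeas Iv.
pose H (z : T1 * T2) := (cis (- p z.1 z.2) * u z.1) * v z.2.
have mH : cmeas H.
  apply: cmeasM; first apply: cmeasM.
  - by apply: cmeas_cis; exact: measurable_funN.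
  - exact: (cmeas_comp mu (@measurable_fst _ _ _ _)).
  - exact: (cmeas_comp mv (@measurable_snd _ _ _ _)).
have Hoo : (\int[m1]_x \int[m2]_y (normc (H (x, y)))%:E < +oo)%E.
  have -> : (\int[m1]_x \int[m2]_y (normc (H (x, y)))%:E =
      (\int[m2]_y (normc (v y))%:E) * \int[m1]_x (normc (u x))%:E)%E.
    rewrite -ge0_integralZl//=.
    - apply: eq_integral => x _; rewrite muleC -ge0_integralZl//=.
      + apply: eq_integral => y _.
        by rewrite /H /= !normcM normc_cis mul1r EFinM.
      + exact/measurable_EFinP/measurable_normc.
      + by move=> y _; rewrite lee_fin normc_ge0.
      + by rewrite lee_fin normc_ge0.
    - exact/measurable_EFinP/measurable_normc.
    - by move=> y _; rewrite lee_fin normc_ge0.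
    - by apply: integral_ge0 => y _; rewrite lee_fin normc_ge0.
  apply: lte_mul_pinfty.
  - by apply: integral_ge0 => y _; rewrite lee_fin normc_ge0.
  - rewrite ge0_fin_numE; first exact: L1_ltoo.
    by apply: integral_ge0 => y _; rewrite lee_fin normc_ge0.
  - exact: L1_ltoo.
have [_ _ E1 [_ E2]] := cint_fubini mH Hoo.
have mp2 : measurable_fun setT (fun z : T2 * T1 => p z.2 z.1).
  exact: (measurableT_comp mp (measurable_fun_pair
    (@measurable_snd _ _ T2 T1) (@measurable_fst _ _ T2 T1))).
rewrite (eq_cint _ (g := fun y => cint m1 (fun x => H (x, y)))); last first.
  move=> y; rewrite mulrC -cintZl; last exact: L1_ft.
  by apply: eq_cint => x; rewrite /H /= mulrC.
rewrite E2 -E1; apply: eq_cint => x; rewrite -cintZl; last first.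
  exact: (@L1_ft _ _ _ _ _ m2 (fun y x => p x y) mp2 v x Iv).
by apply: eq_cint => y; rewrite /H /= -mulrA mulrCA.
Qed.

End multiplication_formula.

(** Phase and constant are parameters because the property passes to products, where phases add and
    constants multiply. *)
Definition plancherel {d} {T : measurableType d} {R : realType}
    (m : {measure set T -> \bar R}) (p : T -> T -> R) (c : R) :=
  forall h, L1 m h -> L2 m h ->
     N2 m (fun xi => cint m (fun x => cis (- p x xi) * h x)) = (c%:E * N2 m h)%E.

(** * Plancherel's identity on a product space *)

Section plancherel_product.
Context {d1 d2} {T1 : measurableType d1} {T2 : measurableType d2} {R : realType}.
Variable m1 : {sigma_finite_measure set T1 -> \bar R}.
Variable m2 : {sigma_finite_measure set T2 -> \bar R}.
Variables (p1 : T1 -> T1 -> R) (p2 : T2 -> T2 -> R).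
Hypothesis mp1 : measurable_fun setT (fun z : T1 * T1 => p1 z.1 z.2).
Hypothesis mp2 : measurable_fun setT (fun z : T2 * T2 => p2 z.1 z.2).
Variables c1 c2 : R.
Hypotheses (c1_ge0 : 0 <= c1) (c2_ge0 : 0 <= c2).
Hypothesis PL1 : plancherel m1 p1 c1.
Hypothesis PL2 : plancherel m2 p2 c2.

Let P (z w : T1 * T2) := p1 z.1 w.1 + p2 z.2 w.2.

(** The second variable is transformed first, giving [k]. Almost every section h(x, .) lies in L^1
    and L^2, so [PL2] computes the norm of [k]. This norm being finite, almost every section k(., y)
    lies in L^2, while Fubini puts all of them in L^1; hence [PL1] applies to almost all of them. *)
Lemma plancherel_product : plancherel (m1 \x m2)%E P (c1 * c2).
Proof.
move=> h Ih I2h; have mh := L1_cmeas Ih.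
pose k (z : T1 * T2) := ft m2 p2 (fun y => h (z.1, y)) z.2.
have mhx x : cmeas (fun y => h (x, y)).
  exact: (cmeas_comp mh (measurable_fun_pair (@measurable_cst _ _ _ _ _ x) (@measurable_id _ _ _))).
have mk : cmeas k.
  apply: (@cmeas_cint _ _ _ _ _ m2 (fun w : (T1 * T2) * T2 =>
    cis (- p2 w.2 w.1.2) * h (w.1.1, w.2))).
  apply: cmeasM.
    apply: cmeas_cis; apply: measurable_funN.
    apply: (measurableT_comp mp2 (g := fun w : (T1 * T2) * T2 => (w.2, w.1.2))).
    apply: measurable_fun_pair; first exact: measurable_snd.
    exact: (measurableT_comp (@measurable_snd _ _ T1 T2) (@measurable_fst _ _ (T1 * T2)%type T2)).
  apply: (cmeas_comp mh (phi := fun w : (T1 * T2) * T2 => (w.1.1, w.2))).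
  apply: measurable_fun_pair; last exact: measurable_snd.
  exact: (measurableT_comp (@measurable_fst _ _ T1 T2) (@measurable_fst _ _ (T1 * T2)%type T2)).
have tonelli1 u : cmeas u ->
    (N2 (m1 \x m2)%E u = \int[m1]_x N2 m2 (fun y => u (x, y)))%E.
  move=> mu; rewrite /N2 fubini_tonelli1//.
    exact/measurable_EFinP/measurable_sqn.
  by move=> z; rewrite lee_fin sqn_ge0.
have tonelli2 u : cmeas u ->
    (N2 (m1 \x m2)%E u = \int[m2]_y N2 m1 (fun x => u (x, y)))%E.
  move=> mu; rewrite /N2 fubini_tonelli2//.
    exact/measurable_EFinP/measurable_sqn.
  by move=> z; rewrite lee_fin sqn_ge0.
have mN1 (u : T1 * T2 -> R[i]) : cmeas u ->
     measurable_fun setT (fun x => N2 m2 (fun y => u (x, y))).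
  move=> mu; have := @measurable_fun_fubini_tonelli_F _ _ _ _ _ m2 (fun z => (sqn (u z))%:E).
  apply; first exact/measurable_EFinP/measurable_sqn.
  by move=> z; rewrite lee_fin sqn_ge0.
have mN2 (u : T1 * T2 -> R[i]) : cmeas u ->
     measurable_fun setT (fun y => N2 m1 (fun x => u (x, y))).
  move=> mu; have := @measurable_fun_fubini_tonelli_G _ _ _ _ _ m1 (fun z => (sqn (u z))%:E).
  apply; first exact/measurable_EFinP/measurable_sqn.
  by move=> z; rewrite lee_fin sqn_ge0.
have aeL1 : {ae m1, forall x, L1 m2 (fun y => h (x, y))}.
  have [ir ii] := Ih.
  by have := ae_integrable1 ir; have := ae_integrable1 ii; apply: filterS2.
have aeL2 : {ae m1, forall x, L2 m2 (fun y => h (x, y))}.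
  have := ae_integrable1 (L2_sqn I2h); apply: filterS => x /integrableP[_].
  by under eq_integral do rewrite abse_EFin ger0_norm ?sqn_ge0//.
have N2k : N2 (m1 \x m2)%E k = (c2%:E * N2 (m1 \x m2)%E h)%E.
  rewrite !tonelli1// -ge0_integralZl//; [|exact: mN1|by move=> ? _; exact: N2_ge0].
  apply: ge0_ae_eq_integral => //.
  - exact: mN1.
  - by apply: emeasurable_funM => //; exact: mN1.
  - by move=> x _; exact: N2_ge0.
  - by move=> x _; rewrite mule_ge0// N2_ge0.
  - by apply: filterS2 aeL1 aeL2 => x i1 i2 _; rewrite -PL2.
have I2k : L2 (m1 \x m2)%E k.
  by split=> //; rewrite N2k lte_mul_pinfty//; case: I2h.
have aek : {ae m2, forall y, L2 m1 (fun x => k (x, y))}.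
  have := ae_integrable2 (L2_sqn I2k); apply: filterS => y /integrableP[_].
  under eq_integral do rewrite abse_EFin ger0_norm ?sqn_ge0//.
  move=> koo; split => //.
  exact: (cmeas_comp mk (measurable_fun_pair (@measurable_id _ _ _) (@measurable_cst _ _ _ _ _ y))).
have HI (a : T1 * T2 -> R) :
    (\int[m1]_x \int[m2]_y (normc (cis (a (x, y)) * h (x, y)))%:E < +oo)%E.
  rewrite [ltLHS](_ : _ = \int[m1]_x \int[m2]_y (normc (h (x, y)))%:E)%E; last first.
    apply: eq_integral => x _; apply: eq_integral => y _.
    by rewrite normcM normc_cis mul1r.
  have := L1_ltoo Ih; rewrite fubini_tonelli1//=.
    exact/measurable_EFinP/measurable_normc.
  by move=> z; rewrite lee_fin normc_ge0.
have mphase y : cmeas (fun z : T1 * T2 => cis (- p2 z.2 y)).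
  apply: cmeas_cis; apply: (measurableT_comp (measurable_phase mp2 y)).
  exact: measurable_snd.
have L1k y : L1 m1 (fun x => k (x, y)).
  by have [_ + _ _] := cint_fubini (cmeasM (mphase y) mh) (HI (fun z => - p2 z.2 y)).
pose u (w : T1 * T2) := ft m1 p1 (fun x => k (x, w.2)) w.1.
have mu : cmeas u.
  apply: (@cmeas_cint _ _ _ _ _ m1 (fun w : (T1 * T2) * T1 =>
    cis (- p1 w.2 w.1.1) * k (w.2, w.1.2))).
  apply: cmeasM.
    apply: cmeas_cis; apply: measurable_funN.
    apply: (measurableT_comp mp1 (g := fun w : (T1 * T2) * T1 => (w.2, w.1.1))).
    apply: measurable_fun_pair; first exact: measurable_snd.
    exact: (measurableT_comp (@measurable_fst _ _ T1 T2) (@measurable_fst _ _ (T1 * T2)%type T1)).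
  apply: (cmeas_comp mk (phi := fun w : (T1 * T2) * T1 => (w.2, w.1.2))).
  apply: measurable_fun_pair; first exact: measurable_snd.
  exact: (measurableT_comp (@measurable_snd _ _ T1 T2) (@measurable_fst _ _ (T1 * T2)%type T1)).
(* The phase [P] is a sum, so its exponential splits. The inner integrals are matched with [k] only
   where h(x, .) is in L^1, that is, for almost every x; the outer integral does not see the
   difference. *)
have ftE w : cint (m1 \x m2)%E (fun z => cis (- P z w) * h z) = u w.
  have mPw : cmeas (fun z => cis (- P z w)).
    apply: cmeas_cis; apply: measurable_funN; apply: measurable_funD.
      have := measurableT_comp (measurable_phase mp1 w.1) (@measurable_fst _ _ T1 T2).
      by move=> /measurable_funN; under [X in _ X]eq_fun do rewrite /= opprK.
    have := measurableT_comp (measurable_phase mp2 w.2) (@measurable_snd _ _ T1 T2).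
    by move=> /measurable_funN; under [X in _ X]eq_fun do rewrite /= opprK.
  have [] := cint_fubini (cmeasM mPw mh) (HI (fun z => - P z w)).
  move=> _ [/measurable_int/measurable_EFinP mr /measurable_int/measurable_EFinP mi] <- _.
  apply: ae_eq_cint => //; first exact: (L1_cmeas (L1_ft mp1 w.1 (L1k w.2))).
  apply: filterS aeL1 => x Ix; rewrite -cintZl; last exact: (L1_ft mp2).
  by apply: eq_cint => y; rewrite mulrA -cisD /P /= opprD.
have -> : N2 (m1 \x m2)%E (fun w => cint (m1 \x m2)%E (fun z => cis (- P z w) * h z)) =
    N2 (m1 \x m2)%E u by apply: eq_N2 => w; rewrite ftE.
rewrite EFinM -muleA -N2k !tonelli2// -ge0_integralZl//; [|exact: mN2|by move=> ? _; exact: N2_ge0].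
apply: ge0_ae_eq_integral => //.
- exact: mN2.
- by apply: emeasurable_funM => //; exact: mN2.
- by move=> x _; exact: N2_ge0.
- by move=> x _; rewrite mule_ge0// N2_ge0.
- by apply: filterS aek => y i2 _; rewrite -PL1.
Qed.

End plancherel_product.

(** * Primitives and improper integrals *)

Section derivatives.
Context {R : realType}.
Implicit Types (f g : R -> R) (x a b : R).

Lemma is_derive1D f g x a b : is_derive x 1 f a -> is_derive x 1 g b ->
  is_derive x 1 (fun y => f y + g y) (a + b).
Proof. by move=> ? ?; exact: is_deriveD. Qed.

Lemma is_derive1M f g x a b : is_derive x 1 f a -> is_derive x 1 g b ->
  is_derive x 1 (fun y => f y * g y) (f x * b + g x * a).
Proof. by move=> ? ?; exact: is_deriveM. Qed.

Lemma is_derive1Ml f x a b : is_derive x 1 f a ->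
  is_derive x 1 (fun y => b * f y) (b * a).
Proof. by move=> ?; exact: is_deriveZ. Qed.

Lemma is_derive1_compE f g x a b : is_derive x 1 f a -> is_derive (f x) 1 g b ->
  is_derive x 1 (fun y => g (f y)) (b * a).
Proof. by move=> ? ?; exact: is_derive1_comp. Qed.

Lemma is_derive1_continuous (f df : R -> R) : (forall x, is_derive x 1 f (df x)) -> continuous f.
Proof.
move=> fdf x; apply: differentiable_continuous; apply/derivable1_diffP.
by have [] := fdf x.
Qed.

Lemma FTC2y_ge0 (f F : R -> R) (a l : R) : continuous f -> (forall x, 0 <= f x) ->
  (forall x, is_derive x 1 F (f x)) -> F x @[x --> +oo] --> l ->
  (\int[lebesgue_measure]_(x in `[a, +oo[) (f x)%:E = (l - F a)%:E)%E.
Proof.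
move=> cf f0 dF Fl; rewrite (ge0_continuous_FTC2y _ _ Fl)//.
- exact: continuous_subspaceT.
- by apply: cvg_at_right_filter; exact: (is_derive1_continuous dF).
- by move=> x _; rewrite derive1E; have [] := dF x.
Qed.

Lemma FTC2_segment (f F : R -> R) (a b : R) : a < b -> continuous f ->
  (forall x, is_derive x 1 F (f x)) ->
  (\int[lebesgue_measure]_(x in `[a, b]) (f x)%:E = (F b - F a)%:E)%E.
Proof.
move=> ab cf dF; rewrite (@continuous_FTC2 _ f F)//.
- exact: continuous_subspaceT.
- split.
  + by move=> x _; have [] := dF x.
  + by apply: cvg_at_right_filter; exact: (is_derive1_continuous dF).
  + by apply: cvg_at_left_filter; exact: (is_derive1_continuous dF).
- by move=> x _; rewrite derive1E; have [] := dF x.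
Qed.

Lemma ge0_integralT_fold f : continuous f -> (forall x, 0 <= f x) ->
  (\int[lebesgue_measure]_x (f x)%:E =
   \int[lebesgue_measure]_(x in `[0%R, +oo[) (f x + f (- x))%:E)%E.
Proof.
move=> cf f0.
have mf : measurable_fun [set: R] f by exact: continuous_measurable_fun.
have mposnums : measurable [set x : R | 0 <= x] by rewrite -set_itvcy.
rewrite -(setUv [set x : R | 0 <= x]) ge0_integral_setU//= ; last 4 first.
  exact: measurableC.
  by apply/measurable_EFinP; rewrite setUv.
  by move=> x _; rewrite lee_fin.
  exact/disj_setPCl.
rewrite -set_itvcy// setCitvr.
rewrite integral_itv_bndo_bndc; last exact/measurable_EFinP/measurable_funTS.
have := @ge0_integration_by_substitutionNy R f 0; rewrite oppr0 => ->//; last first.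
  exact: continuous_subspaceT.
under [RHS]eq_integral do rewrite EFinD.
rewrite ge0_integralD//=.
- by move=> x _; rewrite lee_fin.
- exact/measurable_EFinP/measurable_funTS.
- by move=> x _; rewrite lee_fin.
- apply/measurable_EFinP/measurable_funTS; apply: (measurableT_comp mf).
  exact: measurable_funN.
Qed.

End derivatives.

(** * The Abel weight and the Poisson kernel *)

Section poisson_kernel.
Context {R : realType}.
Implicit Types (e x z : R).
Local Notation mu := (@lebesgue_measure R).

Definition abel e x := expR (- (e * `|x|)).
(** The Fourier transform of [abel e]: 2 pi times the Poisson kernel of total mass 1. *)
Definition poisson e z := 2 * e / (e ^+ 2 + z ^+ 2).

Lemma abel_ge0 e x : 0 <= abel e x. Proof. exact: expR_ge0. Qed.

Lemma abelN e x : abel e (- x) = abel e x. Proof. by rewrite /abel normrN. Qed.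

Lemma continuous_abel e : continuous (abel e).
Proof.
move=> x; apply: (@continuous_comp _ _ _ (fun x => - (e * `|x|)) expR).
  by apply: continuousN; apply: continuousM; [exact: cvg_cst|exact: norm_continuous].
exact: continuous_expR.
Qed.

Lemma poisson_den_gt0 e z : 0 < e -> 0 < e ^+ 2 + z ^+ 2.
Proof. by move=> e0; rewrite ltr_pwDl ?exprn_gt0 ?sqr_ge0. Qed.

Lemma poisson_ge0 e z : 0 < e -> 0 <= poisson e z.
Proof.
by move=> e0; rewrite divr_ge0 ?(ltW (poisson_den_gt0 _ e0))// mulr_ge0 ?ltW.
Qed.

(* The summand 1 makes the integrand nonnegative, so that the improper integral
   can be computed from a primitive. *)
Lemma integral_half_line_abel_cos e z : 0 < e ->
  (\int[mu]_(x in `[0%R, +oo[) (expR (- (e * x)) * (1 + cos (z * x)))%:E =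
   (e^-1 + e / (e ^+ 2 + z ^+ 2))%:E)%E.
Proof.
move=> e0; have D0 := poisson_den_gt0 z e0.
have e0' := ltW e0; have D0' := ltW D0.
have dlin (a x : R) : is_derive x 1 (fun y => a * y) a.
  by rewrite -[X in is_derive _ _ _ X]mulr1; apply: is_derive1Ml; exact: is_derive_id.
have dexp (x : R) : is_derive x 1 (fun y => expR (- (e * y))) (- e * expR (- (e * x))).
  rewrite mulrC; apply: (@is_derive1_compE R (fun y => - (e * y)) expR).
have dcos (x : R) : is_derive x 1 (fun y => cos (z * y)) (- z * sin (z * x)).
  have -> : - z * sin (z * x) = - sin (z * x) * z by ring.
  exact: (@is_derive1_compE R (fun y => z * y) cos).
have dsin (x : R) : is_derive x 1 (fun y => sin (z * y)) (z * cos (z * x)).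
  rewrite mulrC.
  exact: (@is_derive1_compE R (fun y => z * y) sin).
(* The second part of this primitive is the real part of exp((-e + iz)x) / (-e + iz); the first is
   the primitive of exp(-ex). *)
pose F x := expR (- (e * x)) * (- e^-1 + (e ^+ 2 + z ^+ 2)^-1 *
  (z * sin (z * x) + (- e) * cos (z * x))).
have dcst (a x : R) : is_derive x 1 (fun=> a : R) 0 by exact: is_derive_cst.
pose f x := expR (- (e * x)) * (1 + cos (z * x)).
have cf : continuous f.
  apply: (@is_derive1_continuous _ _ (fun x => expR (- (e * x)) * (0 + - z * sin (z * x)) +
     (1 + cos (z * x)) * (- e * expR (- (e * x))))) => x.
  by apply: is_derive1M; exact: is_derive1D.
have f0 x : 0 <= f x by rewrite mulr_ge0 ?expR_ge0// -lerBlDl sub0r cos_geN1.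
have dF x : is_derive x 1 F (f x).
  apply: (is_derive_eq (is_derive1M (dexp x) (is_derive1D (dcst _ x) (is_derive1Ml _
      (is_derive1D (is_derive1Ml _ (dsin x)) (is_derive1Ml _ (dcos x))))))).
  by rewrite /f; field; rewrite !gt_eqF.
have lF : F x @[x --> +oo] --> (0 : R).
  pose C := e^-1 + (e ^+ 2 + z ^+ 2)^-1 * (`|z| + e).
  have Ex : expR (- (e * x)) @[x --> +oo] --> (0 : R).
    apply: (cvg_comp (fun x => e * x) (fun x => expR (- x))); last exact: cvgr_expR.
    by apply: gt0_cvgMry => //; exact: cvg_id.
  apply: (@squeeze_cvgr _ _ _ _ (fun x => expR (- (e * x)) * - C)
      (fun x => expR (- (e * x)) * C)).
  + apply: nearW => x; rewrite mulrN -ler_norml.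
    rewrite /F normrM ger0_norm ?expR_ge0// ler_wpM2l ?expR_ge0//.
    rewrite (le_trans (ler_normD _ _))// normrN ger0_norm ?invr_ge0// /C lerD2l.
    rewrite normrM ger0_norm ?invr_ge0// ler_wpM2l ?invr_ge0//.
    rewrite (le_trans (ler_normD _ _))// !normrM normrN (lerD _ _)//.
      by rewrite ler_piMr// ler_norml sin_le1 sin_geN1.
    by rewrite (ger0_norm e0') ler_piMr// ler_norml cos_le1 cos_geN1.
  + by rewrite -(mul0r (- C)); apply: cvgMl.
  + by rewrite -(mul0r C); apply: cvgMl.
rewrite (FTC2y_ge0 0 cf f0 dF lF); congr EFin.
rewrite /F !mulr0 oppr0 expR0 sin0 cos0.
by field; rewrite !gt_eqF.
Qed.

Lemma continuous_abelM e (u : R -> R) : continuous u ->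
  continuous (fun x => abel e x * (1 + u x)).
Proof.
move=> cu x; apply: cvgM; first exact: continuous_abel.
by apply: cvgD; [exact: cvg_cst|exact: cu].
Qed.

Lemma continuousZ (g : R -> R) z : continuous g -> continuous (fun x => g (z * x)).
Proof.
move=> cg x; apply: (@continuous_comp _ _ _ (fun x => z * x) g); last exact: cg.
by apply: cvgM; [exact: cvg_cst|exact: cvg_id].
Qed.

Lemma integral_abel_cos e z : 0 < e ->
  (\int[mu]_x (abel e x * (1 + cos (z * x)))%:E = (2 * e^-1 + poisson e z)%:E)%E.
Proof.
move=> e0; rewrite ge0_integralT_fold; last 2 first.
- by apply: continuous_abelM; exact: (@continuousZ _ _ (@continuous_cos R)).
- by move=> x; rewrite mulr_ge0 ?abel_ge0// -lerBlDl sub0r cos_geN1.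
rewrite (_ : 2 * e^-1 + poisson e z = 2 * (e^-1 + e / (e ^+ 2 + z ^+ 2))); last first.
  by rewrite /poisson; ring.
rewrite EFinM -(integral_half_line_abel_cos z e0) -ge0_integralZl//.
- apply: eq_integral => x; rewrite inE/= in_itv/= andbT => x0.
  by rewrite abelN mulrN cosN /abel ger0_norm// -EFinM; congr EFin; ring.
- apply/measurable_EFinP; apply: measurable_funTS; apply: continuous_measurable_fun.
  move=> x; apply: cvgM.
    apply: (@continuous_comp _ _ _ (fun x => - (e * x)) expR); last exact: continuous_expR.
    by apply: cvgN; apply: cvgM; [exact: cvg_cst|exact: cvg_id].
  by apply: cvgD; [exact: cvg_cst|exact: (@continuousZ _ _ (@continuous_cos R))].
Qed.

Lemma integral_abel_sin e z : 0 < e ->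
  (\int[mu]_x (abel e x * (1 + sin (z * x)))%:E = (2 * e^-1)%:E)%E.
Proof.
move=> e0; rewrite ge0_integralT_fold; last 2 first.
- by apply: continuous_abelM; exact: (@continuousZ _ _ (@continuous_sin R)).
- by move=> x; rewrite mulr_ge0 ?abel_ge0// -lerBlDl sub0r sin_geN1.
(* The sine is odd and cancels in the folding; what is left, 2 exp(-ex), is the cosine integrand at
   z = 0. *)
rewrite (_ : 2 * e^-1 = e^-1 + e / (e ^+ 2 + 0 ^+ 2)); last first.
  by field; rewrite gt_eqF.
rewrite -(integral_half_line_abel_cos 0 e0).
apply: eq_integral => x; rewrite inE/= in_itv/= andbT => x0.
by rewrite abelN mulrN sinN mul0r cos0 /abel ger0_norm//; congr EFin; ring.
Qed.

Lemma integral_abel e : 0 < e -> (\int[mu]_x (abel e x)%:E = (2 * e^-1)%:E)%E.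
Proof.
move=> e0; rewrite -(integral_abel_sin 0 e0); apply: eq_integral => x _.
by rewrite mul0r sin0 addr0 mulr1.
Qed.

Lemma measurable_abel e : measurable_fun setT (abel e).
Proof. by apply: continuous_measurable_fun; exact: continuous_abel. Qed.

Lemma integrable_abel e : 0 < e -> mu.-integrable setT (EFin \o abel e).
Proof.
move=> e0; apply/integrableP; split; first by apply/measurable_EFinP; exact: measurable_abel.
under eq_integral do rewrite /= ger0_norm ?abel_ge0//.
by rewrite integral_abel// ltry.
Qed.

Lemma ft_abel e z : 0 < e ->
  cint mu (fun x => cis (- (x * z)) * (abel e x)%:C) = (poisson e z)%:C.
Proof.
move=> e0.
(* Subtracting the integral of [abel e], which is 2 / e, removes the auxiliary summand 1. *)
have iG (u : R -> R) c : continuous u -> (forall x, 0 <= 1 + u x) ->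
    (\int[mu]_x (abel e x * (1 + u x))%:E = c%:E)%E ->
    \int[mu]_x (abel e x * u x) = c - 2 * e^-1.
  move=> cu u0 iu; have cG := continuous_abelM cu (e := e).
  have IG : mu.-integrable setT (EFin \o (fun x => abel e x * (1 + u x))).
    apply/integrableP; split.
      by apply/measurable_EFinP; exact: continuous_measurable_fun.
    under eq_integral do rewrite /= ger0_norm ?mulr_ge0 ?abel_ge0//.
    by rewrite iu ltry.
  rewrite (_ : 2 * e^-1 = \int[mu]_x abel e x); last first.
    by rewrite /Rintegral integral_abel.
  rewrite (_ : c = \int[mu]_x (abel e x * (1 + u x))); last first.
    by rewrite /Rintegral iu.
  rewrite -RintegralB//; last exact: integrable_abel.
  by apply: eq_Rintegral => x _; ring.
apply: complex_ext; rewrite /=.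
  rewrite [RHS](_ : _ = 2 * e^-1 + poisson e z - 2 * e^-1); last by ring.
  rewrite -(iG _ _ _ _ (integral_abel_cos z e0)).
  - by apply: eq_Rintegral => x _; rewrite /= cosN mulrC [x * z]mulrC mulr0 subr0.
  - by exact: (@continuousZ _ _ (@continuous_cos R)).
  - by move=> x; rewrite -lerBlDl sub0r cos_geN1.
rewrite [RHS](_ : _ = 2 * e^-1 - 2 * e^-1); last by ring.
rewrite -(iG _ _ _ _ (integral_abel_sin (- z) e0)).
- apply: eq_Rintegral => x _; rewrite /= mulr0 add0r mulrC; congr (_ * sin _).
  by ring.
- by exact: (@continuousZ _ _ (@continuous_sin R)).
- by move=> x; rewrite -lerBlDl sub0r sin_geN1.
Qed.

Lemma continuous_poisson e : 0 < e -> continuous (poisson e).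
Proof.
move=> e0 z; apply: cvgM; first exact: cvg_cst.
apply: cvgV; first by rewrite gt_eqF// poisson_den_gt0.
apply: cvgD; first exact: cvg_cst.
exact: exprn_continuous.
Qed.

Lemma is_derive_poisson e z : 0 < e ->
  is_derive z 1 (fun y => 2 * atan (y / e)) (poisson e z).
Proof.
move=> e0; have dl : is_derive z 1 (fun y => y / e) e^-1.
  have -> : (fun y : R => y / e) = (fun y => e^-1 * y) by apply/funext => y; rewrite mulrC.
  by rewrite -[X in is_derive _ _ _ X]mulr1; apply: is_derive1Ml; exact: is_derive_id.
have := is_derive1Ml 2 (is_derive1_compE dl (is_derive1_atan (z / e))).
move=> /is_derive_eq; apply; rewrite /poisson.
have D0 := poisson_den_gt0 z e0.
by field; rewrite ?gt_eqF//= ?poisson_den_gt0.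
Qed.

Lemma poissonN e z : poisson e (- z) = poisson e z.
Proof. by rewrite /poisson sqrrN. Qed.

Lemma is_derive_poisson_shift e (a y : R) : 0 < e ->
  is_derive y 1 (fun y => 2 * atan ((y + a) / e)) (poisson e (y + a)).
Proof.
move=> e0; rewrite -[X in is_derive _ _ _ X]mulr1.
apply: (@is_derive1_compE R (fun y => y + a) (fun y => 2 * atan (y / e))).
  rewrite -[X in is_derive _ _ _ X]addr0.
  exact: is_derive1D.
exact: is_derive_poisson.
Qed.

Lemma continuous_poisson_shift e (a : R) : 0 < e -> continuous (fun y => poisson e (y + a)).
Proof.
move=> e0 y; apply: (@continuous_comp _ _ _ (fun y => y + a) (poisson e)).
  by apply: cvgD; [exact: cvg_id|exact: cvg_cst].
exact: continuous_poisson.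
Qed.

Lemma poissonB e x y : poisson e (x - y) = poisson e (y + - x).
Proof. by rewrite -poissonN opprB. Qed.

Lemma integral_poisson e x : 0 < e ->
  (\int[mu]_y (poisson e (x - y))%:E = (2 * pi)%:E)%E.
Proof.
move=> e0; under eq_integral do rewrite poissonB.
have P0 z : 0 <= poisson e z by exact: poisson_ge0.
rewrite ge0_integralT_fold//; last exact: continuous_poisson_shift.
under eq_integral do rewrite -(poissonN e (- _ - _)) opprD !opprK.
have cP : continuous (fun y => poisson e (y - x) + poisson e (y + x)).
  by move=> y; apply: cvgD; exact: continuous_poisson_shift.
have dP (y : R) : is_derive y 1 (fun y => 2 * atan ((y - x) / e) + 2 * atan ((y + x) / e))
    (poisson e (y - x) + poisson e (y + x)).
  by have := is_derive_poisson_shift; move=> H; apply: is_derive1D; apply: H.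
have lim (a : R) : 2 * atan ((y + a) / e) @[y --> +oo] --> (pi : R).
  rewrite -[X in _ --> X](_ : 2 * (pi / 2) = pi); last by field.
  apply: cvgM; first exact: cvg_cst.
  apply: (cvg_comp (fun y => (y + a) / e) (@atan R)); last exact: cvgy_atan.
  apply: gt0_cvgMly; first by rewrite invr_gt0.
  apply/cvgryPge => A; near=> y; rewrite -lerBlDr; near: y.
  exact/nbhs_pinfty_ge/num_real.
have P0' y : 0 <= poisson e (y - x) + poisson e (y + x) by exact: addr_ge0.
rewrite (FTC2y_ge0 0 cP P0' dP (cvgD (lim (- x)) (lim x))).
by rewrite !add0r mulNr atanN; congr EFin; ring.
Unshelve. all: by end_near. Qed.

(** The value tends to the full mass 2 pi as r / e grows, so a short segment around x carries almost
    all of the kernel when e is much smaller than r. *)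
Lemma integral_poisson_segment e x (r : R) : 0 < e -> 0 < r ->
  (\int[mu]_(y in `[(x - r)%R, (x + r)%R]) (poisson e (x - y))%:E = (4 * atan (r / e))%:E)%E.
Proof.
move=> e0 r0; under eq_integral do rewrite poissonB.
have dF (y : R) : is_derive y 1 (fun y => 2 * atan ((y - x) / e)) (poisson e (y - x)).
  exact: is_derive_poisson_shift.
have ab : x - r < x + r by rewrite ltrD2l gtrN.
rewrite (FTC2_segment ab (continuous_poisson_shift e0) dF); congr EFin.
have -> : x + r - x = r by ring.
have -> : x - r - x = - r by ring.
by rewrite mulNr atanN; ring.
Qed.

End poisson_kernel.

Lemma EFin_Re_cint {d} {T : measurableType d} {R : realType}
    (mu : {measure set T -> \bar R}) (f : T -> R[i]) : L1 mu f ->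
  (cre (cint mu f))%:E = (\int[mu]_x (cre (f x))%:E)%E.
Proof. by move=> [ir _]; rewrite /= fineK//; exact: integrable_fin_num. Qed.

(** * The damped energy of a transform as a double integral *)

Section energy_identity.
Context {R : realType}.
Local Notation mu := (@lebesgue_measure R).
Implicit Types (h : measurableTypeR R -> R[i]) (e : R).

Definition energy_kernel h e (z : measurableTypeR R * measurableTypeR R) : R[i] :=
  h z.1 * ((h z.2)^*%C * (poisson e (z.1 - z.2))%:C).

Lemma measurable_mulr_pair :
  measurable_fun setT (fun z : measurableTypeR R * measurableTypeR R => z.1 * z.2).
Proof. by apply: measurable_funM; [exact: measurable_fst|exact: measurable_snd]. Qed.

Lemma poisson_le e z : 0 < e -> poisson e z <= 2 / e.
Proof.
move=> e0; rewrite /poisson ler_pdivrMr ?poisson_den_gt0//.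
rewrite [leRHS](_ : _ = 2 * e + 2 / e * z ^+ 2); last by field; rewrite gt_eqF.
by rewrite lerDl mulr_ge0 ?sqr_ge0// divr_ge0// ltW.
Qed.

Lemma cmeas_energy_kernel h e : 0 < e -> cmeas h -> cmeas (energy_kernel h e).
Proof.
move=> e0 mh; apply: cmeasM; first exact: (cmeas_comp mh (@measurable_fst _ _ _ _)).
apply: cmeasM.
  exact: (cmeas_comp (cmeasJ mh) (@measurable_snd _ _ _ _)).
apply: cmeas_real.
have mP : measurable_fun setT (poisson e).
  by apply: continuous_measurable_fun; exact: continuous_poisson.
apply: (measurableT_comp mP).
by apply: measurable_funB; [exact: measurable_fst|exact: measurable_snd].
Qed.

(** The Poisson kernel is at most 2 / e, so the modulus is dominated by (2 / e) |h(x)| |h(y)|. *)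
Lemma L1_energy_kernel h e : 0 < e -> L1 mu h ->
  (\int[mu]_x \int[mu]_y (normc (energy_kernel h e (x, y)))%:E < +oo)%E.
Proof.
move=> e0 Ih; have mh := L1_cmeas Ih; have mk := cmeas_energy_kernel e0 mh.
have Hoo := L1_ltoo Ih.
have n0 x : (0 <= (normc (h x))%:E)%E by rewrite lee_fin normc_ge0.
have mn : measurable_fun setT (fun x => (normc (h x))%:E).
  by apply/measurable_EFinP; exact: measurable_normc.
have e20 : 0 <= 2 / e by rewrite divr_ge0// ltW.
have I0 : (0 <= \int[mu]_y (normc (h y))%:E)%E by exact: integral_ge0.
apply: (@le_lt_trans _ _ (\int[mu]_x ((2 / e)%:E * (\int[mu]_y (normc (h y))%:E) *
    (normc (h x))%:E))%E).
  apply: ge0_le_integral => //=.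
  - by move=> x _; apply: integral_ge0 => y _; rewrite lee_fin normc_ge0.
  - apply: (@measurable_fun_fubini_tonelli_F _ _ _ _ _ mu
      (fun z => (normc (energy_kernel h e z))%:E)).
      by apply/measurable_EFinP; exact: measurable_normc.
    by move=> z; rewrite lee_fin normc_ge0.
  - by apply: emeasurable_funM => //; exact: measurable_cst.
  - move=> x _; rewrite muleAC -ge0_integralZl//=; last first.
      by rewrite mule_ge0.
    apply: ge0_le_integral => //=.
    + by move=> y _; rewrite lee_fin normc_ge0.
    + apply/measurable_EFinP; apply: measurable_normc.
      exact: (cmeas_comp mk
        (measurable_fun_pair (@measurable_cst _ _ _ _ _ x) (@measurable_id _ _ _))).
    + by apply: emeasurable_funM => //; exact: measurable_cst.
    + move=> y _; rewrite -!EFinM lee_fin /energy_kernel /= !normcM.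
      rewrite [normc (_ ^*%C)]normc_sqrt sqnJ -normc_sqrt.
      rewrite [X in _ * (_ * X)]normc_sqrt sqn_real sqrtr_sqr ger0_norm ?poisson_ge0//.
      rewrite [leRHS](_ : _ = normc (h x) * (normc (h y) * (2 / e))); last by ring.
      by rewrite !ler_wpM2l ?normc_ge0// poisson_le.
rewrite ge0_integralZl//.
- apply: lte_mul_pinfty => //; first by rewrite mule_ge0.
  rewrite ge0_fin_numE ?mule_ge0//.
  by rewrite lte_mul_pinfty.
- by rewrite mule_ge0.
Qed.

(* By Fubini, since the Fourier transform of [abel e] is [poisson e]. *)
Lemma abel_energy h e : 0 < e -> L1 mu h ->
  (\int[mu]_xi (abel e xi * sqn (ft mu *%R h xi))%:E =
   \int[(mu \x mu)%E]_z (cre (energy_kernel h e z))%:E)%E.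
Proof.
move=> e0 Ih; have mh := L1_cmeas Ih.
pose M := 2 * \int[mu]_x normc (h x).
pose g := ft mu *%R h.
have gM xi : normc (g xi) <= M.
  exact: (@normc_ft_le _ _ _ _ _ mu _ measurable_mulr_pair h xi Ih).
have M0 : 0 <= M by exact: (le_trans (normc_ge0 (g 0)) (gM 0)).
have mg : cmeas g by exact: (@cmeas_ft _ _ _ _ _ mu _ measurable_mulr_pair h mh).
have mW := cmeas_real (measurable_abel e).
have IW := integrable_abel e0.
have normcW xi : normc (abel e xi)%:C = abel e xi.
  by rewrite normc_sqrt sqn_real sqrtr_sqr ger0_norm ?abel_ge0.
pose v xi := (g xi)^*%C * (abel e xi)%:C.
have Iv : L1 mu v.
  apply: (@L1_le _ _ _ mu (fun x => M * abel e x)).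
  - by apply: cmeasM; [exact: cmeasJ|].
  - move=> x; rewrite normcM normcW [normc _^*%C]normc_sqrt sqnJ -normc_sqrt.
    by rewrite ler_wpM2r ?abel_ge0.
  - exact: (integrableZl measurableT M IW).
have Igv : L1 mu (fun xi => g xi * v xi).
  apply: (@L1_le _ _ _ mu (fun x => M * M * abel e x)).
  - exact: (cmeasM mg (L1_cmeas Iv)).
  - move=> x; rewrite !normcM normcW [normc _^*%C]normc_sqrt sqnJ -normc_sqrt mulrA.
    by rewrite ler_wpM2r ?abel_ge0// ler_pM ?normc_ge0.
  - exact: (integrableZl measurableT (M * M) IW).
have -> : (\int[mu]_xi (abel e xi * sqn (ft mu *%R h xi))%:E =
    (cre (cint mu (fun xi => g xi * v xi)))%:E)%E.
  rewrite EFin_Re_cint//; apply: eq_integral => xi _; congr EFin.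
  by rewrite /v /sqn !ReIm /= -/(g xi); ring.
have [IH _ E _] := cint_fubini (cmeas_energy_kernel e0 mh) (L1_energy_kernel e0 Ih).
rewrite (_ : cint mu (fun xi => g xi * v xi) = cint (mu \x mu)%E (energy_kernel h e)).
  by rewrite EFin_Re_cint.
(* The transform moves from [h] onto [v]; it remains to identify the transform of [v] at x with the
   inner integral of the kernel. *)
rewrite (ft_multiplication measurable_mulr_pair Ih Iv) -E.
apply: eq_cint => x; rewrite /energy_kernel /=.
have mhP : L1 mu (fun y => (h y)^*%C * (poisson e (x - y))%:C).
  have iM : 0 <= 2 / e by rewrite divr_ge0// ltW.
  have mP : cmeas (fun y : measurableTypeR R => (poisson e (x - y))%:C).
    apply: cmeas_real; apply: continuous_measurable_fun.
    have -> : (fun y => poisson e (x - y)) = (fun y => poisson e (y + - x)).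
      by apply/funext => y; rewrite poissonB.
    exact: continuous_poisson_shift.
  apply: (@L1_dom _ _ _ mu _ (fun y => (2 / e)%:C * h y)).
  - by apply: cmeasM => //; exact: cmeasJ.
  - move=> y; rewrite !normcM [normc _^*%C]normc_sqrt sqnJ -normc_sqrt mulrC.
    rewrite ler_wpM2r ?normc_ge0//.
    rewrite !normc_sqrt !sqn_real !sqrtr_sqr !ger0_norm ?poisson_ge0//.
    exact: poisson_le.
  - exact: L1Zl.
rewrite cintZl//; congr (_ * _).
have mq : measurable_fun setT (fun z : measurableTypeR R * measurableTypeR R => - (z.1 * z.2)).
  by apply: measurable_funN; exact: measurable_mulr_pair.
pose w xi := cis (- (x * xi)) * (abel e xi)%:C.
have Iw : L1 mu w.
  apply: L1_cisM.
    by apply: measurable_funN; apply: measurable_funM => //; exact: measurable_cst.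
  split => //; under eq_fun do rewrite /=.
  exact: integrable0.
(* The conjugate of [g] is the transform of the conjugate of [h] for the opposite phase, so the
   multiplication formula applies a second time. The integral left over xi is [ft_abel] at x - y. *)
transitivity (cint mu (fun xi => ft mu (fun y xi => - (y * xi)) (fun y => (h y)^*%C) xi * w xi)).
  apply: eq_cint => xi; rewrite /v mulrCA; congr (_ * _).
  rewrite /g /ft -cintJ; last exact: (L1_ft measurable_mulr_pair).
  by apply: eq_cint => y; rewrite conjcMr -cisN.
rewrite (ft_multiplication mq (L1J Ih) Iw); apply: eq_cint => y; congr (_ * _).
rewrite -(ft_abel _ e0); apply: eq_cint => xi.
by rewrite /w mulrA -cisD; congr (cis _ * _); ring.
Qed.

End energy_identity.

(** Serves twice: to let the damping tend to 0 on the line, and to pass Cauchy bounds to the limit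
    in the completeness of L^2. *)
Lemma fatou_ae_le {d} {T : measurableType d} {R : realType}
    (mu : {measure set T -> \bar R}) (F : nat -> T -> \bar R) (G : T -> \bar R) (C : \bar R) :
  (forall k, measurable_fun setT (F k)) -> (forall k x, (0 <= F k x)%E) ->
  measurable_fun setT G -> {ae mu, forall x, F k x @[k --> \oo] --> G x} ->
  (\forall k \near \oo, (\int[mu]_x F k x <= C)%E) -> (\int[mu]_x G x <= C)%E.
Proof.
move=> mF F0 mG FG FC.
have mL : measurable_fun setT (fun x => limn_einf (F^~ x)).
  rewrite (_ : (fun x => _) = (fun x => - limn_esup (fun k => - F k x))%E); last first.
    by apply/funext => x; rewrite -[X in limn_esup X]/(-%E \o F^~ x) limn_esupN oppeK.
  apply: measurableT_comp => //.
  by apply: measurable_fun_limn_esup => k; exact: measurableT_comp.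
rewrite (_ : (\int[mu]_x G x = \int[mu]_x limn_einf (F^~ x))%E); last first.
  apply: ae_eq_integral => //; apply: filterS FG => x FGx _.
  by rewrite (cvg_limn_einf_sup FGx).1.
apply: (@le_trans _ _ (limn_einf (fun k => \int[mu]_x F k x)%E)).
  by apply: fatou => // k x _; exact: F0.
rewrite limn_einf_lim; apply: lime_le; first exact: is_cvg_einfs.
near=> k; apply: (@le_trans _ _ (\int[mu]_x F k x)%E).
  by apply: ereal_inf_lbound; exists k => /=.
by near: k.
Unshelve. all: by end_near. Qed.

(** * The upper bound in Plancherel's identity on the line *)

Section plancherel_line_upper_bound.
Context {R : realType}.
Local Notation mu := (@lebesgue_measure R).
Implicit Types (h : measurableTypeR R -> R[i]) (e : R).

Lemma abel_energy_le h e : 0 < e -> L1 mu h -> L2 mu h ->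
  (\int[mu]_xi (abel e xi * sqn (ft mu *%R h xi))%:E <= (2 * pi)%:E * N2 mu h)%E.
Proof.
move=> e0 Ih I2h; rewrite abel_energy//.
have mh := L1_cmeas Ih; have mk := cmeas_energy_kernel e0 mh.
have [[Ik _] _ _ _] := cint_fubini mk (L1_energy_kernel e0 Ih).
(* The two halves of the AM-GM bound for Re(h(x) conj(h(y))). In each, the variable absent from [h]
   is integrated first and yields the Poisson mass 2 pi, so each contributes pi |h|^2. *)
pose a (z : measurableTypeR R * measurableTypeR R) := (sqn (h z.1) / 2 * poisson e (z.1 - z.2))%:E.
pose b (z : measurableTypeR R * measurableTypeR R) := (sqn (h z.2) / 2 * poisson e (z.1 - z.2))%:E.
have P0 z : 0 <= poisson e z by exact: poisson_ge0.
have a0 z : (0 <= a z)%E.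
  by rewrite lee_fin mulr_ge0// divr_ge0// sqn_ge0.
have b0 z : (0 <= b z)%E.
  by rewrite lee_fin mulr_ge0// divr_ge0// sqn_ge0.
have mP : measurable_fun setT
    (fun z : measurableTypeR R * measurableTypeR R => poisson e (z.1 - z.2)).
  have mP : measurable_fun setT (poisson e).
    by apply: continuous_measurable_fun; exact: continuous_poisson.
  apply: (measurableT_comp mP).
  by apply: measurable_funB; [exact: measurable_fst|exact: measurable_snd].
have ms := measurable_sqn mh.
have ma : measurable_fun setT a.
  apply/measurable_EFinP; apply: measurable_funM => //.
  apply: measurable_funM; last exact: measurable_cst.
  exact: (measurableT_comp ms (@measurable_fst _ _ _ _)).
have mb : measurable_fun setT b.
  apply/measurable_EFinP; apply: measurable_funM => //.
  apply: measurable_funM; last exact: measurable_cst.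
  exact: (measurableT_comp ms (@measurable_snd _ _ _ _)).
have Pint x : (\int[mu]_y (poisson e (x - y))%:E = (2 * pi)%:E)%E by exact: integral_poisson.
have Pint' y : (\int[mu]_x (poisson e (x - y))%:E = (2 * pi)%:E)%E.
  rewrite -(Pint y); apply: eq_integral => x _.
  by rewrite -(poissonN e (x - y)) opprB.
have mP1 x : measurable_fun setT (fun y : measurableTypeR R => (poisson e (x - y))%:E).
  apply/measurable_EFinP.
  exact: (measurableT_comp mP
    (measurable_fun_pair (@measurable_cst _ _ _ _ _ x) (@measurable_id _ _ _))).
have mP2 y : measurable_fun setT (fun x : measurableTypeR R => (poisson e (x - y))%:E).
  apply/measurable_EFinP.
  exact: (measurableT_comp mP
    (measurable_fun_pair (@measurable_id _ _ _) (@measurable_cst _ _ _ _ _ y))).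
have half : (\int[mu]_x ((sqn (h x) / 2)%:E * (2 * pi)%:E) = pi%:E * N2 mu h)%E.
  rewrite /N2 -ge0_integralZl//=.
  - by apply: eq_integral => x _; rewrite -!EFinM; congr EFin; field.
  - exact/measurable_EFinP.
  - by move=> x _; rewrite lee_fin sqn_ge0.
  - by rewrite lee_fin pi_ge0.
have Ia : (\int[(mu \x mu)%E]_z a z = pi%:E * N2 mu h)%E.
  rewrite fubini_tonelli1// -half; apply: eq_integral => x _.
  rewrite /fubini_F /a /=; under eq_integral do rewrite EFinM.
  rewrite ge0_integralZl//; [by rewrite Pint|by move=> y _; rewrite lee_fin|].
  by rewrite lee_fin divr_ge0// sqn_ge0.
have Ib : (\int[(mu \x mu)%E]_z b z = pi%:E * N2 mu h)%E.
  rewrite fubini_tonelli2// -half; apply: eq_integral => y _.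
  rewrite /fubini_G /b /=; under eq_integral do rewrite EFinM.
  rewrite ge0_integralZl//; [by rewrite Pint'|by move=> x _; rewrite lee_fin|].
  by rewrite lee_fin divr_ge0// sqn_ge0.
have Iab : (\int[(mu \x mu)%E]_z (a z + b z) = (2 * pi)%:E * N2 mu h)%E.
  rewrite ge0_integralD// Ia Ib -ge0_muleDl ?lee_fin ?pi_ge0// -EFinD.
  by congr (_%:E * _)%E; ring.
rewrite -Iab; apply: le_integral => //.
  apply/integrableP; split; first exact: emeasurable_funD.
  under eq_integral do rewrite gee0_abs ?adde_ge0//.
  rewrite Iab lte_mul_pinfty//; first by rewrite lee_fin mulr_ge0// pi_ge0.
  by case: I2h.
have creMr (u v : R[i]) (r : R) : cre (u * (v * r%:C)) = cre (u * v) * r.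
  by rewrite mulrA [LHS]creM /= mulr0 subr0.
move=> [x y] _; rewrite /a /b -EFinD lee_fin -mulrDl /energy_kernel creMr ler_wpM2r// [in leRHS]/=.
rewrite [(_, _).1]/= [(_, _).2]/=.
have := sqn_ge0 (h x - h y); rewrite sqnB_expand; lra.
Qed.

(** The weights with e = 1 / (k + 1) tend to 1 pointwise and the damped bounds are uniform in e, so
    Fatou's lemma applies. In particular the transform lies in L^2. *)
Lemma plancherel_line_le h : L1 mu h -> L2 mu h ->
  (N2 mu (ft mu *%R h) <= (2 * pi)%:E * N2 mu h)%E.
Proof.
move=> Ih I2h.
have mF : cmeas (ft mu *%R h).
  by apply: cmeas_ft; [exact: measurable_mulr_pair|exact: L1_cmeas Ih].
apply: (@fatou_ae_le _ _ _ mu (fun k xi => (abel k.+1%:R^-1 xi * sqn (ft mu *%R h xi))%:E)).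
- move=> k; apply/measurable_EFinP; apply: measurable_funM; first exact: measurable_abel.
  exact: measurable_sqn.
- by move=> k x; rewrite lee_fin mulr_ge0 ?abel_ge0 ?sqn_ge0.
- by apply/measurable_EFinP; exact: measurable_sqn.
- apply: aeW => x; apply: cvg_EFin; first exact: nearW.
  have c0 : (k.+1%:R^-1 : R) @[k --> \oo] --> (0 : R) by exact: cvg_harmonic.
  have c1 : - (k.+1%:R^-1 * `|x|) @[k --> \oo] --> - (0 * `|x|).
    by apply: cvgN; apply: cvgM => //; exact: cvg_cst.
  have := cvg_comp _ _ c1 (@continuous_expR R (- (0 * `|x|))).
  rewrite mul0r oppr0 expR0 => c2.
  rewrite -[X in _ --> X]mul1r; apply: cvgM; last exact: cvg_cst.
  exact: c2.
- by apply: nearW => k; apply: abel_energy_le.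
Qed.

End plancherel_line_upper_bound.

Lemma N2_dominated_cvg {d} {T : measurableType d} {R : realType}
    (mu : {measure set T -> \bar R}) (h_ : nat -> T -> R[i]) (h : T -> R[i]) (g : T -> \bar R) :
  (forall k, cmeas (h_ k)) -> cmeas h -> mu.-integrable setT g ->
  (forall x, sqn (h_ k x - h x) @[k --> \oo] --> (0 : R)) ->
  (forall k x, ((sqn (h_ k x - h x))%:E <= g x)%E) ->
  N2 mu (fun x => h_ k x - h x) @[k --> \oo] --> 0%E.
Proof.
move=> mh_ mh ig h0 hg.
have [] := @dominated_convergence _ _ _ mu setT measurableT
  (fun k x => (sqn (h_ k x - h x))%:E) (cst 0%E) g.
- move=> k; apply/measurable_EFinP; apply: measurable_sqn.
  exact: cmeasB.
- exact: measurable_cst.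
- by apply: aeW => x _; apply: cvg_EFin; [exact: nearW|exact: h0].
- exact: ig.
- apply: aeW => k x _.
  by rewrite /= ger0_norm ?sqn_ge0.
by move=> _ _; rewrite integral0.
Qed.

Lemma ler_limn {R : realType} (u v : nat -> R) (a b : R) :
  u k @[k --> \oo] --> a -> v k @[k --> \oo] --> b -> (forall k, u k <= v k) -> a <= b.
Proof. by move=> ua vb uv; apply: (ler_cvg_to ua vb); exact: nearW. Qed.

(** * Equality on the line through the zeros of the defect *)

Section plancherel_line.
Context {R : realType}.

(** The unreduced [2 * 0] in this and the next fact are what a vanishing defect leaves after
    rewriting in the parallelogram law. *)
Let ge0_sum_eq0 (a b : R) : 0 <= a -> 0 <= b -> a + b = 2 * 0 + 2 * 0 -> a = 0.
Proof. lra. Qed.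

Let half_sum_le (p a b c n : R) :
  a + b = 2 * 0 + 2 * c -> 0 <= b -> c <= 2 * p * n -> a <= 4 * p * n.
Proof. lra. Qed.

Let sub_parallelogram (p a b c d A B C D : R) :
  A + B = 2 * C + 2 * D -> a + b = 2 * c + 2 * d ->
  p * a - A + (p * b - B) = 2 * (p * c - C) + 2 * (p * d - D).
Proof. by move=> H1 /(congr1 ( *%R p)); lra. Qed.

Local Notation mu := (@lebesgue_measure R).
Implicit Types (f g h : measurableTypeR R -> R[i]).

Let F h := ft mu *%R h.

Definition L12 h := L1 mu h /\ L2 mu h.

Let L2F h : L12 h -> L2 mu (F h).
Proof.
move=> [Ih I2h]; split.
  by apply: cmeas_ft; [exact: measurable_mulr_pair|exact: L1_cmeas Ih].
apply: le_lt_trans (plancherel_line_le Ih I2h) _.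
by rewrite lte_mul_pinfty// ?lee_fin ?mulr_ge0 ?pi_ge0//; case: I2h.
Qed.

(* A nonnegative quadratic form on the intersection of L^1 and L^2; by the
   parallelogram law its zeros form a linear subspace, closed for the norm of
   L^2. *)
Definition defect h : R := 2 * pi * fine (N2 mu h) - fine (N2 mu (F h)).

Let pi2 : 0 <= 2 * pi :> R. Proof. by rewrite mulr_ge0 ?pi_ge0. Qed.

Lemma defect_ge0 h : L12 h -> 0 <= defect h.
Proof.
move=> Ih; rewrite subr_ge0 -lee_fin EFinM fineK; last exact/N2_fin/L2F.
by case: Ih => I1 I2; rewrite fineK ?N2_fin//; exact: plancherel_line_le.
Qed.

Lemma defect_le h : defect h <= 2 * pi * fine (N2 mu h).
Proof. by rewrite gerDl oppr_le0 fine_ge0// N2_ge0. Qed.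

Lemma L12D f g : L12 f -> L12 g -> L12 (fun x => f x + g x).
Proof. by move=> [? ?] [? ?]; split; [exact: L1D|exact: L2D]. Qed.

Lemma L12B f g : L12 f -> L12 g -> L12 (fun x => f x - g x).
Proof. by move=> [? ?] [? ?]; split; [exact: L1B|exact: L2B]. Qed.

Lemma L12Zl c f : L12 f -> L12 (fun x => c * f x).
Proof. by move=> [? ?]; split; [exact: L1Zl|exact: L2Zl]. Qed.

Let fineN2_parallelogram f g : L2 mu f -> L2 mu g ->
  fine (N2 mu (fun x => f x + g x)) + fine (N2 mu (fun x => f x - g x)) =
  2 * fine (N2 mu f) + 2 * fine (N2 mu g).
Proof.
move=> If Ig; have [mf _] := If; have [mg _] := Ig.
apply: EFin_inj; have fp := N2_fin (L2D If Ig); have fm := N2_fin (L2B If Ig).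
rewrite !EFinD !EFinM (fineK fp) (fineK fm) (fineK (N2_fin If)) (fineK (N2_fin Ig)).
exact: N2_parallelogram.
Qed.

Lemma defect_parallelogram f g : L12 f -> L12 g ->
  defect (fun x => f x + g x) + defect (fun x => f x - g x) =
  2 * defect f + 2 * defect g.
Proof.
move=> If Ig; have [If1 If2] := If; have [Ig1 Ig2] := Ig.
rewrite /defect /F ftD ?ftB//; [|exact: measurable_mulr_pair..].
by apply: sub_parallelogram; [exact: fineN2_parallelogram (L2F If) (L2F Ig)|
  exact: fineN2_parallelogram].
Qed.

Lemma defectZ c f : L12 f -> defect (fun x => c * f x) = sqn c * defect f.
Proof.
move=> If; have [If1 If2] := If.
have [m1 _] := If2; have [m2 _] := L2F If.
rewrite /defect /F ftZl//; last exact: measurable_mulr_pair.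
rewrite !N2Zl// !fineM ?N2_fin//; last exact: L2F.
by rewrite /=; ring.
Qed.

Definition isom h := L12 h /\ defect h = 0.

Lemma isomD f g : isom f -> isom g -> isom (fun x => f x + g x).
Proof.
move=> [If f0] [Ig g0]; split; first exact: L12D.
apply: (ge0_sum_eq0 (defect_ge0 (L12D If Ig)) (defect_ge0 (L12B If Ig))).
by rewrite defect_parallelogram// f0 g0.
Qed.

Lemma isomZ c f : isom f -> isom (fun x => c * f x).
Proof.
by move=> [If f0]; split; [exact: L12Zl|rewrite defectZ// f0 mulr0].
Qed.

Lemma isomB f g : isom f -> isom g -> isom (fun x => f x - g x).
Proof.
move=> If /(isomZ (-1)) Ig; have := isomD If Ig.
by under eq_fun do rewrite mulN1r.
Qed.

Lemma isom0 : isom (fun=> 0).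
Proof.
have L0 : L12 (fun=> 0).
  split; first by split; exact: integrable0.
  split; first exact: cmeas_cst.
  by rewrite /N2; under eq_integral do rewrite sqn0; rewrite integral0.
split => //; rewrite (_ : (fun=> 0) = (fun x => 0 * (fun=> 0) x)); last first.
  by apply/funext => x; rewrite mul0r.
by rewrite defectZ// sqn0 mul0r.
Qed.

(** Write h = h_k + (h - h_k). As h_k has defect 0, the parallelogram law bounds the defect of h by
    twice that of h - h_k, hence by 4 pi |h - h_k|^2. *)
Lemma isom_lim (h_ : nat -> measurableTypeR R -> R[i]) h :
  L12 h -> (forall k, isom (h_ k)) ->
  N2 mu (fun x => h_ k x - h x) @[k --> \oo] --> 0%E -> isom h.
Proof.
move=> Ih Ih_ h_h; split => //; apply/eqP; rewrite eq_le defect_ge0// andbT.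
have le k : defect h <= 4 * pi * fine (N2 mu (fun x => h_ k x - h x)).
  have [Ik k0] := Ih_ k; have Id := L12B Ih Ik.
  have hE : (fun x => h_ k x + (h x - h_ k x)) = h.
    by apply/funext => x; rewrite addrC subrK.
  have := defect_parallelogram Ik Id; rewrite hE k0 => E.
  by rewrite N2_distC; apply: (half_sum_le E (defect_ge0 (L12B Ik Id)) (defect_le _)).
have c0 : fine (N2 mu (fun x => h_ k x - h x)) @[k --> \oo] --> (0 : R).
  exact: (fine_cvg h_h).
rewrite -(mulr0 (4 * pi)).
apply: (@ler_limn _ (fun=> defect h)
  (fun k => 4 * pi * fine (N2 mu (fun x => h_ k x - h x)))).
- exact: cvg_cst.
- by apply: cvgM => //; exact: cvg_cst.
- exact: le.
Qed.

Definition ind (A : set (measurableTypeR R)) (x : measurableTypeR R) : R[i] := (\1_A x)%:C.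

Lemma sqn_ind A x : sqn (ind A x) = \1_A x.
Proof. by rewrite sqn_real indicE; case: (_ \in _); rewrite /= ?expr1n ?expr0n. Qed.

Lemma integrable_indic_fin A : measurable A -> (mu A < +oo)%E ->
  mu.-integrable setT (fun x => (\1_A x)%:E).
Proof.
move=> mA Aoo; apply/integrableP; split.
  by apply/measurable_EFinP; exact: measurable_indic.
under eq_integral do rewrite abse_EFin ger0_norm//.
by rewrite integral_indic// setIT.
Qed.

Lemma L12_ind A : measurable A -> (mu A < +oo)%E -> L12 (ind A).
Proof.
move=> mA Aoo; have iA : mu.-integrable setT (fun x => (\1_A x)%:E).
  exact: integrable_indic_fin.
split.
  split => //; by under eq_fun do rewrite /=; exact: integrable0.
split.
  apply: cmeas_real; exact: measurable_indic.
rewrite /N2; under eq_integral do rewrite sqn_ind.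
by rewrite integral_indic// setIT.
Qed.

Lemma N2_ind A : measurable A -> N2 mu (ind A) = mu A.
Proof.
move=> mA; rewrite /N2; under eq_integral do rewrite sqn_ind.
by rewrite integral_indic// setIT.
Qed.

(** The weight [abel e] is at most 1, so the damped energy is a lower bound. In its double integral
    over the square of the interval, keep only the x in []a + r, b - r]]: the segment of radius r
    around such an x stays inside the interval, and its Poisson mass is known. *)
Lemma N2_ft_itv_ge (a b r e : R) : 0 < r -> 0 < e -> a + r < b - r ->
  (((b - a - 2 * r) * (4 * atan (r / e)))%:E <= N2 mu (F (ind `]a, b]%classic)))%E.
Proof.
move=> r0 e0 ab; set A := `]a, b]%classic.
have mA : measurable (A : set (measurableTypeR R)) by exact: measurable_itv.
have Aoo : (mu A < +oo)%E.
  by rewrite /= lebesgue_measure_itv; case: ifPn => _; rewrite ?ltry.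
have [IA I2A] := L12_ind mA Aoo; have mi := L1_cmeas IA.
have [mF _] := L2F (conj IA I2A).
have at0 : 0 <= 4 * atan (r / e).
  rewrite mulr_ge0// -atan0; apply: le_atan; by rewrite divr_ge0// ltW.
apply: (@le_trans _ _ (\int[mu]_xi (abel e xi * sqn (ft mu *%R (ind A) xi))%:E)%E); last first.
  apply: ge0_le_integral => //=.
  - by move=> x _; rewrite lee_fin mulr_ge0 ?abel_ge0 ?sqn_ge0.
  - apply/measurable_EFinP; apply: measurable_funM; first exact: measurable_abel.
    exact: measurable_sqn.
  - by apply/measurable_EFinP; exact: measurable_sqn.
  - move=> x _; rewrite lee_fin ler_piMl ?sqn_ge0//.
    by rewrite -expR0 ler_expR oppr_le0 mulr_ge0// ltW.
rewrite abel_energy//.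
have kE z : cre (energy_kernel (ind A) e z) = \1_A z.1 * \1_A z.2 * poisson e (z.1 - z.2).
  by rewrite /energy_kernel /ind !creM !cimM /=; ring.
have k0 z : 0 <= cre (energy_kernel (ind A) e z).
  by rewrite kE mulr_ge0 ?poisson_ge0// mulr_ge0.
have mk : measurable_fun setT (fun z => (cre (energy_kernel (ind A) e z))%:E).
  by apply/measurable_EFinP; case: (cmeas_energy_kernel e0 mi).
rewrite fubini_tonelli1//.
have mJ : measurable (`]a + r, b - r]%classic : set (measurableTypeR R)) by exact: measurable_itv.
apply: (@le_trans _ _ (\int[mu]_x ((4 * atan (r / e))%:E * (\1_`]a + r, b - r]%classic x)%:E))%E).
  rewrite ge0_integralZl//.
  - rewrite integral_indic// setIT /= lebesgue_measure_itv /= lte_fin ab.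
    by rewrite -EFinB -EFinM lee_fin le_eqVlt; apply/orP; left; apply/eqP; ring.
  - by apply/measurable_EFinP; exact: measurable_indic.
apply: ge0_le_integral => //=.
- by move=> x _; rewrite -EFinM lee_fin mulr_ge0.
- by apply: emeasurable_funM => //; apply/measurable_EFinP; exact: measurable_indic.
- exact: measurable_fun_fubini_tonelli_F.
move=> x _; rewrite indicE; have [|_] := boolP (x \in _); last first.
  by rewrite mule0; apply: integral_ge0 => y _; rewrite lee_fin; exact: k0.
rewrite inE /= in_itv /= => /andP[ax xb]; rewrite mule1.
rewrite -(integral_poisson_segment x e0 r0) /fubini_F.
rewrite [leLHS]integral_mkcond; apply: ge0_le_integral => //=.
- by move=> y _; rewrite patchE; case: ifPn => // _; rewrite lee_fin poisson_ge0.
- apply/measurable_restrict => //; apply/measurable_EFinP; apply: measurable_funTS.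
  apply: continuous_measurable_fun.
  have -> : (fun y => poisson e (x - y)) = (fun y => poisson e (y + - x)).
    by apply/funext => y; rewrite poissonB.
  exact: continuous_poisson_shift.
- apply/measurable_EFinP.
  have /measurable_EFinP mk' := mk.
  exact: (measurableT_comp mk'
    (measurable_fun_pair (@measurable_cst _ _ _ _ _ x) (@measurable_id _ _ _))).
- move=> y _; rewrite -[leRHS]/((cre (energy_kernel (ind A) e (x, y)))%:E) patchE.
  case: ifPn => [|_]; last first.
    by rewrite lee_fin; exact: k0.
  move=> yI; have /andP[xy yx] : x - r <= y <= x + r by move: yI; rewrite inE /= in_itv.
  have xA : A x by rewrite /A /= in_itv /=; apply/andP; split; clear -r0 ax xb; lra.
  have yA : A y by rewrite /A /= in_itv /=; apply/andP; split; clear -ax xb xy yx; lra.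
  by rewrite lee_fin kE !indicE !mem_set// !mul1r.
Qed.

Lemma isom_itv a b : isom (ind `]a, b]%classic).
Proof.
have [ab|ba] := ltP a b; last first.
  rewrite (_ : ind _ = fun=> 0); first exact: isom0.
  by apply/funext => x; rewrite set_itv_ge ?bnd_simp -?leNgt// /ind indic0.
have mA : measurable (`]a, b]%classic : set (measurableTypeR R)) by exact: measurable_itv.
have muA : (mu `]a, b]%classic = (b - a)%:E)%E.
  by rewrite /= lebesgue_measure_itv /= lte_fin ab.
have IA : L12 (ind `]a, b]%classic) by apply: L12_ind => //; rewrite muA ltry.
split => //; apply/eqP; rewrite eq_le defect_ge0// andbT.
rewrite /defect N2_ind// muA /= subr_le0.
have c0 : (k.+1%:R^-1 : R) @[k --> \oo] --> (0 : R) by exact: cvg_harmonic.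
have cat : atan (k.+1%:R : R) @[k --> \oo] --> (pi / 2 : R).
  rewrite (cvg_shiftS (fun k => atan (k%:R : R))).
  by apply: (cvg_comp _ _ _ (@cvgy_atan R)); exact: cvgr_idn.
rewrite (_ : 2 * pi * (b - a) = (b - a - 2 * 0) * (4 * (pi / 2))); last by field.
apply: (@ler_limn _ (fun k : nat => (b - a - 2 * k.+1%:R^-1) * (4 * atan k.+1%:R))
  (fun=> fine (N2 mu (F (ind `]a, b]%classic))))).
- apply: cvgM; last by apply: cvgM => //; exact: cvg_cst.
  by apply: cvgB; [exact: cvg_cst|apply: cvgM => //; exact: cvg_cst].
- exact: cvg_cst.
- move=> k; set r : R := k.+1%:R^-1.
  have r0 : 0 < r by rewrite invr_gt0.
  have at0 : 0 <= 4 * atan (k.+1%:R : R).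
    rewrite mulr_ge0// -atan0; exact: le_atan.
  (* For small k the shrunken interval may be empty; the left side is then nonpositive. *)
  have [h|h] := ltP (a + r) (b - r); last first.
    apply: (@le_trans _ _ 0); last by rewrite fine_ge0// N2_ge0.
    by rewrite mulr_le0_ge0//; lra.
  rewrite -lee_fin fineK; last by apply: N2_fin; exact: L2F.
  (* The choice e = r * r gives r / e = k + 1: the margin r tends to 0 while the captured mass tends
     to 2 pi. *)
  have -> : (k.+1%:R : R) = r / (r * r) by rewrite /r; field.
  by apply: N2_ft_itv_ge => //; rewrite mulr_gt0.
Qed.

(** The fixed bounded interval keeps every set of the Dynkin class of finite measure. Complements
    become differences of indicators, and disjoint countable unions become L^2 limits of finite
    sums. *)
Lemma isom_bounded_set (r : R) (A : set (measurableTypeR R)) : measurable A ->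
  isom (ind (A `&` `]- r, r]%classic)).
Proof.
move: A; apply: (@dynkin_induction _ (measurableTypeR R) (@measurable _ (ocitv_type R))
  (fun A => isom (ind (A `&` `]- r, r]%classic)))).
- by [].
- exact: ocitvI.
- by rewrite setTI; exact: isom_itv.
- move=> A oA; have oB : @measurable _ (ocitv_type R) `]- r, r]%classic by exact: is_ocitv.
  have /ocitvP[->|[[a b] /= _ ->]] := ocitvI oA oB; last exact: isom_itv.
  rewrite (_ : ind set0 = fun=> 0); first exact: isom0.
  by apply/funext => x; rewrite /ind indic0.
- move=> A mA IA; rewrite (_ : ind _ =
      fun x => ind `]- r, r]%classic x - ind (A `&` `]- r, r]%classic) x).
    exact: (isomB (isom_itv _ _) IA).
  apply/funext => x; rewrite /ind !indicE !in_setI in_setC.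
  case: (x \in A); case: (x \in _);
    by apply: complex_ext; rewrite ?creB ?cimB /= ?subrr ?subr0.
- move=> B mB tB IB.
  pose U n := \big[setU/set0]_(k < n) B k.
  have mU n : measurable (U n) by apply: bigsetU_measurable => k _.
  have mI : measurable (`]- r, r]%classic : set (measurableTypeR R)) by exact: measurable_itv.
  have Ioo : (mu `](- r)%R, r]%classic < +oo)%E.
    by rewrite /= lebesgue_measure_itv; case: ifPn => _; rewrite ?ltry.
  have iI : mu.-integrable setT (fun x => (\1_`]- r, r]%classic x)%:E).
    exact: integrable_indic_fin.
  have UP n x : reflect (exists2 k, (k < n)%N & B k x) (x \in U n).
    apply: (iffP idP); rewrite inE /U -bigcup_mkord.
      by move=> [k kn Bkx]; exists k.
    by move=> [k kn Bkx]; exists k.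
  have sqnBE (u v : bool) : sqn ((u%:R : R)%:C - (v%:R : R)%:C) = (u != v)%:R.
    by rewrite /sqn creB cimB /=; case: u; case: v => /=; ring.
  have IU n : isom (ind (U n `&` `]- r, r]%classic)).
    elim: n => [|n IHn].
      rewrite (_ : ind _ = fun=> 0); first exact: isom0.
      by apply/funext => x; rewrite /ind /U big_ord0 set0I indic0.
    rewrite (_ : ind _ = fun x => ind (U n `&` `]- r, r]%classic) x +
      ind (B n `&` `]- r, r]%classic) x).
      exact: (isomD IHn (IB n)).
    apply/funext => x; rewrite /ind !indicE !in_setI {1}/U big_ord_recr /= -/(U n) in_setU.
    (* [U n] only collects indices below n, so it is disjoint from [B n] and the two indicators add
       up. *)
    have : ~~ ((x \in U n) && (x \in B n)).
      apply/negP => /andP[/UP[k kn Bkx]]; rewrite inE => Bnx.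
      have /(_ k n I I) := tB.
      move=> /(_ (ex_intro _ x (conj Bkx Bnx))) kE.
      by rewrite kE ltnn in kn.
    apply: contraNeq => /eqP; apply: contra_notT.
    case: (x \in U n); case: (x \in B n); case: (x \in _) => //= _;
      by apply: complex_ext; rewrite ?creD ?cimD /= ?addr0 ?add0r.
  have mAll : measurable (\bigcup_k B k) by exact: bigcup_measurable.
  have UA n x : x \in U n -> x \in \bigcup_k B k.
    by move=> /UP[k _ Bkx]; rewrite inE; exists k.
  apply: (@isom_lim (fun n => ind (U n `&` `]- r, r]%classic))) => //.
    apply: L12_ind; first exact: measurableI.
    apply: le_lt_trans Ioo; apply: le_measure; rewrite ?inE//; exact: measurableI.
  apply: (@N2_dominated_cvg _ _ _ mu _ _ (fun x => (\1_`]- r, r]%classic x)%:E)) => //.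
  + by move=> n; case: (IU n) => -[/L1_cmeas].
  + by apply: cmeas_real; apply: measurable_indic; exact: measurableI.
  + move=> x; apply: cvg_near_cst.
    have [|xN] := boolP (x \in \bigcup_k B k); last first.
      apply: nearW => n; rewrite /ind !indicE sqnBE !in_setI (negbTE xN) /=.
      by rewrite (negbTE (contra (@UA n x) xN)) eqxx.
    rewrite inE => -[k _ Bkx]; exists k.+1 => //= n /= kn.
    rewrite /ind !indicE sqnBE !in_setI.
    have -> : x \in U n by apply/UP; exists k.
    by have -> : x \in \bigcup_k B k; [rewrite inE; exists k|rewrite eqxx].
  + move=> n x; rewrite lee_fin /ind !indicE sqnBE !in_setI.
    by case: (x \in `]- r, r]%classic); rewrite ?andbF ?andbT /= ?lern1 ?leq_b1 ?eqxx.
Qed.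

Lemma isom_sum (I : Type) (s : seq I) (g : I -> measurableTypeR R -> R[i]) :
  (forall i, isom (g i)) -> isom (fun x => \sum_(i <- s) g i x).
Proof.
move=> Ig; elim: s => [|i s IHs].
  by under eq_fun do rewrite big_nil; exact: isom0.
by under eq_fun do rewrite big_cons; exact: (isomD (Ig i) IHs).
Qed.

Import HBNNSimple.

Lemma isom_nnsfun (r : R) (f : {nnsfun measurableTypeR R >-> R}) :
  isom (fun x => (f x * \1_`]- r, r]%classic x)%:C).
Proof.
rewrite (_ : (fun x => _) = (fun x => \sum_(y <- finmap.enum_fset (fset_set (range f)))
    y%:C * ind (f @^-1` [set y] `&` `]- r, r]%classic) x)).
  apply: isom_sum => i; apply: isomZ; apply: isom_bounded_set.
  exact: measurable_sfunP.
apply/funext => x; rewrite (fimfunE f) fsbig_finite//= mulr_suml rmorph_sum.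
apply: eq_bigr => i _; rewrite -mulrA rmorphM; congr (_ * _).
by rewrite /ind indicI.
Qed.

(** Simple functions increasing to u, cut off to []- k, k]], stay between 0 and u. Their squared
    distance to u is thus dominated by u^2, and dominated convergence makes it tend to 0 in mean. *)
Lemma isom_ge0 (u : measurableTypeR R -> R) : (forall x, 0 <= u x) ->
  L12 (fun x => (u x)%:C) -> isom (fun x => (u x)%:C).
Proof.
move=> u0 Iu; have [/L1_cmeas[/= mu' _] I2] := Iu.
have mE : measurable_fun setT (EFin \o u) by exact/measurable_EFinP.
pose a := nnsfun_approx measurableT mE.
have au x : (a k x : R) @[k --> \oo] --> (u x : R).
  have u0' y : setT y -> (0 <= (EFin \o u) y)%E by move=> _; rewrite lee_fin.
  by have /fine_cvg := cvg_nnsfun_approx measurableT mE u0' (x := x) I.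
have ale k x : a k x <= u x.
  rewrite -(cvg_lim _ (au x))//; apply: nondecreasing_cvgn_le.
    by move=> m n mn; have /lefP := nd_nnsfun_approx measurableT mE mn; exact.
  by apply/cvg_ex; exists (u x); exact: au.
apply: (@isom_lim (fun k x => (a k x * \1_`]- k%:R, k%:R]%classic x)%:C)) => //.
  by move=> k; exact: isom_nnsfun.
apply: (N2_dominated_cvg _ _ (L2_sqn I2)).
- by move=> k; have [[/L1_cmeas]] := isom_nnsfun k%:R (a k).
- by case: I2.
- move=> x; rewrite [X in _ --> X](_ : _ = (u x * 1 - u x) ^+ 2 + 0 ^+ 2); last by ring.
  under eq_fun do rewrite /sqn creB cimB /= subrr.
  apply: cvgD; last exact: cvg_cst.
  rewrite expr2; under eq_fun do rewrite expr2.
  have c1 : a k x * \1_`]- k%:R, k%:R]%classic x - u x @[k --> \oo] --> u x * 1 - u x.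
    apply: cvgB; last exact: cvg_cst.
    apply: cvgM => //; apply: cvg_near_cst; near=> k.
    rewrite indicE mem_set//= in_itv /=; apply/andP.
    have : `|x| < k%:R by near: k; exact: nbhs_infty_gtr.
    by rewrite ltr_norml => /andP[-> /ltW].
  exact: cvgM.
- move=> k x; rewrite lee_fin /sqn creB cimB /= subrr expr0n /= !addr0.
  have a0 : 0 <= a k x by [].
  have := ale k x; rewrite indicE; case: (_ \in _) => au'; rewrite ?mulr1 ?mulr0.
    by rewrite -sqrrN opprB lerXn2r ?nnegrE ?subr_ge0// gerBl.
  by rewrite sub0r sqrrN.
Unshelve. all: by end_near. Qed.

Lemma L12_dom f h : L12 h -> cmeas f -> (forall x, normc (f x) <= normc (h x)) -> L12 f.
Proof.
move=> [I1 [m2 I2]] mf fh; split; first exact: L1_dom I1.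
split => //; apply: le_lt_trans I2; apply: le_N2 => // x.
by rewrite -!normc_sqr lerXn2r ?nnegrE ?normc_ge0.
Qed.

(** h is a complex combination of the positive and negative parts of its real and imaginary parts,
    each of which is dominated by |h| and hence covered by [isom_ge0]. *)
Theorem plancherel_line : plancherel mu *%R (2 * pi).
Proof.
move=> h I1 I2; have Ih : L12 h by [].
have [mr mi] := L1_cmeas I1.
have real (u : measurableTypeR R -> R) : measurable_fun setT u ->
    (forall x, `|u x| <= normc (h x)) -> isom (fun x => (u x)%:C).
  move=> mu' uh.
  have pos (v : measurableTypeR R -> R) : measurable_fun setT v ->
      (forall x, `|v x| <= normc (h x)) -> isom (fun x => (Num.max (v x) 0)%:C).
    move=> mv vh; apply: isom_ge0; first by move=> x; rewrite le_max lexx orbT.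
    apply: (L12_dom Ih).
      by apply: cmeas_real; apply: measurable_maxr => //; exact: measurable_cst.
    move=> x; rewrite normc_sqrt sqn_real sqrtr_sqr; apply: le_trans (vh x).
    by rewrite ger0_norm ?le_max ?lexx ?orbT// ge_max normr_ge0 ler_norm.
  have mN : measurable_fun setT (fun x => - u x) by exact: measurable_funN.
  have uN x : `|- u x| <= normc (h x) by rewrite normrN.
  have := isomB (pos _ mu' uh) (pos _ mN uN).
  rewrite (_ : (fun x => _ - _) = (fun x => (u x)%:C))//.
  apply/funext => x; rewrite -rmorphB; congr (_%:C).
  by rewrite !maxEle oppr_le0; case: (leP (u x) 0); case: (leP 0 (u x)); lra.
have := isomD (real _ mr (fun x => normr_Re_le (h x)))
  (isomZ ('i)%C (real _ mi (fun x => normr_Im_le (h x)))).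
rewrite (_ : (fun x => _ + _) = h); last first.
  by apply/funext => x; rewrite -complexE.
move=> [_ /eqP]; rewrite /defect subr_eq0 => /eqP E.
rewrite -[LHS]/(N2 mu (F h)) -(fineK (N2_fin (L2F Ih))) -E EFinM fineK//.
exact: N2_fin.
Qed.

End plancherel_line.

(** * Plancherel's identity on R^n *)

Section lebesgue_measure_tuple.
Context {R : realType}.

Lemma dot_cons n (a b : R) (x y : n.-tuple R) :
  dot [tuple of a :: x] [tuple of b :: y] = a * b + dot x y.
Proof.
rewrite /dot big_ord_recl !tnth0; congr (_ + _).
by apply: eq_bigr => i _; rewrite !tnthS.
Qed.

Lemma measurable_dot n :
  measurable_fun setT (fun z : n.-tuple R * n.-tuple R => dot z.1 z.2).
Proof.
apply: measurable_sum => i; apply: measurable_funM.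
  exact: (measurableT_comp (measurable_tnth i) (@measurable_fst _ _ _ _)).
exact: (measurableT_comp (measurable_tnth i) (@measurable_snd _ _ _ _)).
Qed.

Lemma ge0_integral_lebesgueS n (f : n.+1.-tuple R -> \bar R) :
  measurable_fun setT f -> (forall x, (0 <= f x)%E) ->
  (\int[lebesgue R n.+1]_x f x =
   \int[(lebesgue_measure \x lebesgue R n)%E]_z f (cons_prod z))%E.
Proof.
move=> mf f0.
have := @ge0_integral_pushforward _ _ _ _ _ _ (measurable_cons_prod (R := R) (n := n))
  (lebesgue_measure \x lebesgue R n)%E setT f measurableT mf.
rewrite preimage_setT => <-; last by move=> x _; exact: f0.
by [].
Qed.

Lemma integral_lebesgueS n (f : n.+1.-tuple R -> \bar R) : measurable_fun setT f ->
  (\int[lebesgue R n.+1]_x f x =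
   \int[(lebesgue_measure \x lebesgue R n)%E]_z f (cons_prod z))%E.
Proof.
move=> mf; rewrite integralE [RHS]integralE.
rewrite (ge0_integral_lebesgueS (measurable_funepos mf) (funepos_ge0 f)).
rewrite (ge0_integral_lebesgueS (measurable_funeneg mf) (funeneg_ge0 f)).
by congr (_ - _)%E; apply: eq_integral => z _; rewrite ?funeposE ?funenegE.
Qed.

Lemma cmeas_cons n (h : n.+1.-tuple R -> R[i]) : cmeas h ->
  cmeas (fun z => h (cons_prod z)).
Proof. by move=> mh; exact: (cmeas_comp mh (@measurable_cons_prod R n)). Qed.

Lemma cint_lebesgueS n (h : n.+1.-tuple R -> R[i]) : cmeas h ->
  cint (lebesgue R n.+1) h =
  cint (lebesgue_measure \x lebesgue R n)%E (fun z => h (cons_prod z)).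
Proof.
move=> [mr mi]; apply: complex_ext; rewrite /= /Rintegral integral_lebesgueS//;
  exact/measurable_EFinP.
Qed.

Lemma N2_lebesgueS n (h : n.+1.-tuple R -> R[i]) : cmeas h ->
  N2 (lebesgue R n.+1) h =
  N2 (lebesgue_measure \x lebesgue R n)%E (fun z => h (cons_prod z)).
Proof.
move=> mh; rewrite /N2 ge0_integral_lebesgueS//.
  exact/measurable_EFinP/measurable_sqn.
by move=> x; rewrite lee_fin sqn_ge0.
Qed.

Lemma L1_lebesgueS n (h : n.+1.-tuple R -> R[i]) : L1 (lebesgue R n.+1) h ->
  L1 (lebesgue_measure \x lebesgue R n)%E (fun z => h (cons_prod z)).
Proof.
move=> Ih; have mh := L1_cmeas Ih; apply/L1P; first exact: cmeas_cons.
have := L1_ltoo Ih; rewrite ge0_integral_lebesgueS//.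
  exact/measurable_EFinP/measurable_normc.
by move=> x; rewrite lee_fin normc_ge0.
Qed.

Theorem plancherel_lebesgue n : plancherel (lebesgue R n) (@dot R n) ((2 * pi) ^+ n).
Proof.
elim: n => [|n IHn] h I1 I2.
  (* R^0 is one point with the Dirac mass and phase 0: the transform is the identity, with constant
     1. *)
  have tE (x : 0.-tuple R) : x = [tuple] by exact: tuple0.
  rewrite expr0 mul1e /N2; apply: eq_integral => x _; congr (sqn _)%:E.
  have -> : cint (lebesgue R 0) (fun y => cis (- dot y x) * h y) =
      cis (- dot [tuple] x) * h [tuple].
    have [mr mi] : cmeas (fun y : 0.-tuple R => cis (- dot y x) * h y).
      have mp := measurable_phase (@measurable_dot 0) x.
      exact: (cmeasM (cmeas_cis mp) (L1_cmeas I1)).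
    have RE (u : 0.-tuple R -> R) : measurable_fun setT u ->
        \int[lebesgue R 0]_y u y = u [tuple].
      move=> mu; rewrite /Rintegral integral_dirac//.
        by rewrite diracT mul1e.
      exact/measurable_EFinP.
    by apply: complex_ext; rewrite /= RE.
  by rewrite /dot big_ord0 (tE x); apply: complex_ext; rewrite ?creM ?cimM /= oppr0 cos0 sin0; ring.
have pi2 : 0 <= 2 * pi :> R by rewrite mulr_ge0// pi_ge0.
have mh := L1_cmeas I1.
have PS := @plancherel_product _ _ _ _ _ lebesgue_measure (lebesgue R n) *%R (@dot R n)
  measurable_mulr_pair (@measurable_dot n) _ _ pi2 (exprn_ge0 n pi2) plancherel_line IHn.
have mF : cmeas (fun xi => cint (lebesgue R n.+1) (fun x => cis (- dot x xi) * h x)).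
  exact: (@cmeas_ft _ _ _ _ _ (lebesgue R n.+1) _ (@measurable_dot n.+1) h mh).
rewrite exprS (N2_lebesgueS mh) -PS.
- rewrite (N2_lebesgueS mF); apply: eq_N2 => w; congr (sqn _).
  rewrite cint_lebesgueS.
    by apply: eq_cint => z; rewrite /cons_prod dot_cons.
  by apply: cmeasM => //; apply: cmeas_cis; exact: (measurable_phase (@measurable_dot n.+1)).
- exact: L1_lebesgueS.
- split; first exact: cmeas_cons.
  by rewrite -N2_lebesgueS//; case: I2.
Qed.

End lebesgue_measure_tuple.

(** * Completeness of L^2 and truncation *)

Lemma cvgn_geometric_increments {R : realType} (a : nat -> R) (C : R) :
  (forall i, `|a i.+1 - a i| <= C / 2 ^+ i) -> cvgn a.
Proof.
move=> aC; pose b i := a i.+1 - a i.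
have gE i : geometric C 2^-1 i = C / 2 ^+ i by rewrite /= exprVn.
have cb : cvgn (series b).
  apply: normed_cvg; apply: (@series_le_cvg _ _ (geometric C 2^-1)).
  - by move=> i; exact: normr_ge0.
  - by move=> i; rewrite gE (le_trans (normr_ge0 _) (aC i)).
  - by move=> i; rewrite gE; exact: aC.
  - apply: is_cvg_geometric_series; rewrite ger0_norm ?invr_ge0//.
    by rewrite invf_lt1// ltr1n.
rewrite (_ : a = (fun n => a 0%N + series b n)); first exact: is_cvgD (is_cvg_cst _) cb.
apply/funext => n; have := eq_sum_telescope a n => ->.
by rewrite /series /= /b.
Qed.

Section L2_space.
Context {d} {T : measurableType d} {R : realType} (mu : {measure set T -> \bar R}).
Implicit Types (f g h : T -> R[i]).

Definition n2 f : R := fine (N2 mu f).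

Lemma n2_ge0 f : 0 <= n2 f. Proof. by rewrite fine_ge0// N2_ge0. Qed.

Lemma EFin_n2 f : L2 mu f -> (n2 f)%:E = N2 mu f.
Proof. by move=> /N2_fin ?; rewrite fineK. Qed.

Lemma n2_distC f g : n2 (fun x => f x - g x) = n2 (fun x => g x - f x).
Proof. by rewrite /n2 N2_distC. Qed.

Lemma n2B_le f g h : L2 mu f -> L2 mu g -> L2 mu h ->
  n2 (fun x => f x - h x) <= 2 * n2 (fun x => f x - g x) + 2 * n2 (fun x => g x - h x).
Proof.
move=> If Ig Ih; rewrite -lee_fin EFinD !EFinM.
rewrite (EFin_n2 (L2B If Ih)) (EFin_n2 (L2B If Ig)) (EFin_n2 (L2B Ig Ih)).
by apply: N2B_le; [case: If|case: Ig|case: Ih].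
Qed.

(** Fatou's lemma for |v_j - v_i|^2 with j fixed and i growing: a bound between late terms passes to
    the limit. *)
Lemma L2_limit_bound (v : nat -> T -> R[i]) g (C : \bar R) j : cmeas g ->
  (forall i, cmeas (v i)) ->
  {ae mu, forall x, sqn (v j x - v i x) @[i --> \oo] --> sqn (v j x - g x)} ->
  (\forall i \near \oo, (N2 mu (fun x => (v j x - v i x)%R) <= C)%E) ->
  (N2 mu (fun x => (v j x - g x)%R) <= C)%E.
Proof.
move=> mg mv vg; apply: fatou_ae_le.
- by move=> i; apply/measurable_EFinP; apply: measurable_sqn; exact: cmeasB.
- by move=> i x; rewrite lee_fin sqn_ge0.
- by apply/measurable_EFinP; apply: measurable_sqn; exact: cmeasB.
- by apply: filterS vg => x vgx; apply: cvg_EFin; [exact: nearW|].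
Qed.

Lemma cvg_sqnB (z : nat -> R[i]) (w a : R[i]) :
  cre (z i) @[i --> \oo] --> cre w -> cim (z i) @[i --> \oo] --> cim w ->
  sqn (a - z i) @[i --> \oo] --> sqn (a - w).
Proof.
move=> zr zi; rewrite /sqn creB cimB.
under eq_fun do rewrite creB cimB.
by apply: cvgD; (under eq_fun do rewrite expr2); rewrite expr2; apply: cvgM;
  apply: cvgB => //; exact: cvg_cst.
Qed.

(* The gap between the rates 8 and 4 turns the bound on the norms into an almost
   everywhere geometric bound. *)
Lemma ae_summable_increments (v : nat -> T -> R[i]) (C : R) :
  (forall i, L2 mu (v i)) ->
  (forall i, n2 (fun x => v i.+1 x - v i x) <= C / 8 ^+ i) ->
  {ae mu, forall x, exists M, forall i, sqn (v i.+1 x - v i x) <= M / 4 ^+ i}.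
Proof.
move=> Iv vC.
pose D i x := (4 ^+ i * sqn (v i.+1 x - v i x))%:E.
have D0 i x : (0 <= D i x)%E by rewrite lee_fin mulr_ge0 ?sqn_ge0// exprn_ge0.
have mD i : measurable_fun setT (D i).
  apply/measurable_EFinP; apply: measurable_funM; first exact: measurable_cst.
  by apply: measurable_sqn; apply: cmeasB; [case: (Iv i.+1)|case: (Iv i)].
have mS : measurable_fun setT (fun x => \sum_(i <oo) D i x)%E.
  by apply: ge0_emeasurable_sum => // k x _ _; exact: D0.
have S0 x : (0 <= \sum_(i <oo) D i x)%E by apply: nneseries_ge0 => i _ _.
have ID i : (\int[mu]_x D i x <= (C / 2 ^+ i)%:E)%E.
  rewrite /D; under eq_integral do rewrite EFinM.
  rewrite ge0_integralZl//.
  - rewrite -[X in (_ * X)%E]/(N2 mu _) -(EFin_n2 (L2B (Iv i.+1) (Iv i))) -EFinM lee_fin.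
    rewrite (le_trans (ler_wpM2l _ (vC i))) ?exprn_ge0//.
    rewrite le_eqVlt; apply/orP; left; apply/eqP.
    have -> : (8 : R) = 4 * 2 by rewrite -natrM.
    by rewrite exprMn; field; rewrite !expf_neq0.
  - apply/measurable_EFinP.
    by apply: measurable_sqn; apply: cmeasB; [case: (Iv i.+1)|case: (Iv i)].
  - by move=> x _; rewrite lee_fin sqn_ge0.
have C0 : 0 <= C.
  by have := le_trans (n2_ge0 _) (vC 0%N); rewrite expr0 divr1.
have Soo : (\int[mu]_x (\sum_(i <oo) D i x) < +oo)%E.
  rewrite integral_nneseries//.
  apply: (@le_lt_trans _ _ (\sum_(i <oo) (C / 2 ^+ i)%:E)%E).
    by apply: lee_nneseries => [i *|i *]; [apply: integral_ge0 => x _; exact: D0|exact: ID].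
  rewrite (_ : (fun n => _) = EFin \o series (geometric C 2^-1)); last first.
    apply/funext => n /=; rewrite sumEFin /series /=.
    by congr EFin; apply: eq_bigr => i _; rewrite exprVn.
  rewrite EFin_lim ?ltry//; apply: is_cvg_geometric_series; rewrite ger0_norm ?invr_ge0//.
  by rewrite invf_lt1// ltr1n.
have : mu.-integrable setT (fun x => \sum_(i <oo) D i x)%E.
  by apply/integrableP; split => //; under eq_integral do rewrite gee0_abs//.
move=> /(integrable_ae measurableT); apply: filterS => x /(_ I) Sx.
exists (fine (\sum_(i <oo) D i x)%E) => i.
rewrite ler_pdivlMr ?exprn_gt0// mulrC -lee_fin fineK//.
have := @nneseries_lim_ge R (D^~ x) predT 0 i.+1 (fun k _ _ => D0 k x).
apply: le_trans; rewrite big_nat_recr//= leeDr// sume_ge0//.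
Qed.

(** Stated for a geometric rate only: the sequences completed below are selected with this rate. *)
Lemma L2_complete (v : nat -> T -> R[i]) (C : R) : (forall i, L2 mu (v i)) ->
  (forall i, n2 (fun x => v i.+1 x - v i x) <= C / 8 ^+ i) ->
  exists2 g, L2 mu g & n2 (fun x => v i x - g x) @[i --> \oo] --> (0 : R).
Proof.
move=> Iv vC; have mv i : cmeas (v i) by case: (Iv i).
have C0 : 0 <= C.
  by have := le_trans (n2_ge0 _) (vC 0%N); rewrite expr0 divr1.
(* With c = C / 8^i, the induction step gives 2c + 2 (4c / 8) = 3c, below 4c: the rate 8 absorbs the
   factor 2 of the quasi-triangle inequality. *)
have tail i m : n2 (fun x => v i x - v (i + m)%N x) <= 4 * C / 8 ^+ i.
  elim: m i => [|m IHm] i.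
    rewrite addn0 /n2 (@eq_N2 _ _ _ mu _ (fun=> 0)); last first.
      by move=> x; rewrite subrr.
    rewrite /N2; under eq_integral do rewrite sqn0.
    by rewrite integral0 divr_ge0 ?mulr_ge0// exprn_ge0.
  rewrite addnS -addSn.
  have h1 : n2 (fun x => v i x - v i.+1 x) <= C / 8 ^+ i by rewrite n2_distC.
  have h2 : n2 (fun x => v i.+1 x - v (i.+1 + m)%N x) <= 2^-1 * (C / 8 ^+ i).
    rewrite (le_trans (IHm i.+1))// exprS le_eqVlt; apply/orP; left; apply/eqP.
    by field; rewrite expf_neq0.
  have c0 : 0 <= C / 8 ^+ i by rewrite divr_ge0// exprn_ge0.
  apply: (le_trans (n2B_le (Iv i) (Iv i.+1) (Iv _))).
  rewrite -(mulrA 4 C).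
  apply: (@le_trans _ _ (2 * (C / 8 ^+ i) + 2 * (2^-1 * (C / 8 ^+ i)))).
    by apply: lerD; rewrite ler_wpM2l.
  by move: (C / 8 ^+ i) c0 => c c0; clear -c0; lra.
(* An upper limit is measurable for every sequence and equals the limit wherever there is one, so no
   null set has to be removed. *)
pose gr x := fine (limn_esup (fun i => (cre (v i x))%:E)).
pose gi x := fine (limn_esup (fun i => (cim (v i x))%:E)).
pose g x := gr x +i* gi x.
have mg : cmeas g.
  split; apply: (@measurableT_comp _ _ _ _ _ _ (@fine R)) => //;
    apply: measurable_fun_limn_esup => i; apply/measurable_EFinP;
    by case: (mv i).
have aeg : {ae mu, forall x, cre (v i x) @[i --> \oo] --> cre (g x) /\
    cim (v i x) @[i --> \oo] --> cim (g x)}.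
  apply: filterS (ae_summable_increments Iv vC) => x [M Mx].
  have M0 : 0 <= M.
    by have := le_trans (sqn_ge0 _) (Mx 0%N); rewrite expr0 divr1.
  (* Taking roots turns the rate 4 of the squares into the rate 2, still summable. *)
  have lim (u : nat -> R) : (forall i, u i ^+ 2 <= sqn (v i.+1 x - v i x)) ->
      forall i, `|u i| <= Num.sqrt M / 2 ^+ i.
    move=> uM i; rewrite -sqrtr_sqr -[leRHS]ger0_norm ?divr_ge0 ?sqrtr_ge0 ?exprn_ge0//.
    rewrite -sqrtr_sqr ler_sqrt ?sqr_ge0//.
    rewrite (le_trans (uM i))// (le_trans (Mx i))//.
    rewrite expr_div_n sqr_sqrtr// -exprM mulnC exprM.
    by rewrite (_ : (2 : R) ^+ 2 = 4)// -natrX.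
  have fin (u : nat -> R) : cvgn u -> u i @[i --> \oo] --> fine (limn_esup (fun i => (u i)%:E)).
    move=> /cvg_ex[l ul].
    have /cvg_limn_einf_sup[_ ->] : (u i)%:E @[i --> \oo] --> l%:E.
      by apply: cvg_EFin => //; exact: nearW.
    exact: ul.
  split; apply: fin; apply: cvgn_geometric_increments; apply: lim => i.
    by rewrite -creB /sqn lerDl sqr_ge0.
  by rewrite -cimB /sqn lerDr sqr_ge0.
have vg i : (N2 mu (fun x => (v i x - g x)%R) <= (4 * C / 8 ^+ i)%:E)%E.
  apply: (L2_limit_bound mg mv).
    by apply: filterS aeg => x [gxr gxi]; exact: cvg_sqnB.
  exists i => // j /= ij; rewrite -(EFin_n2 (L2B (Iv i) (Iv j))) lee_fin.
  by rewrite -(subnKC ij); exact: tail.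
have Ivg i : L2 mu (fun x => v i x - g x).
  by split; [exact: cmeasB|rewrite (le_lt_trans (vg i))// ltry].
exists g.
  have := L2B (Iv 0%N) (Ivg 0%N).
  by under eq_fun do rewrite opprB addrC subrK.
apply: (@squeeze_cvgr _ _ _ _ (cst 0) (geometric (4 * C) 8^-1)).
- apply: nearW => i; rewrite n2_ge0/= exprVn -lee_fin EFin_n2//.
- exact: cvg_cst.
- apply: cvg_geometric; rewrite ger0_norm ?invr_ge0//.
  by rewrite invf_lt1// ltr1n.
Qed.

Lemma L2_dom_cvg (B : nat -> set T) f : (forall k, measurable (B k)) ->
  (forall x, \forall k \near \oo, B k x) -> L2 mu f ->
  n2 (fun x => (\1_(B k) x)%:C * f x - f x) @[k --> \oo] --> (0 : R).
Proof.
move=> mB Bx If; apply: fine_cvg.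
have mf : cmeas f by case: If.
have E k x : sqn ((\1_(B k) x)%:C * f x - f x) = (x \notin B k)%:R * sqn (f x).
  rewrite indicE; case: (x \in B k) => /=.
    by rewrite mul1r subrr sqn0 mul0r.
  by rewrite mul0r sub0r sqnN mul1r.
apply: (N2_dominated_cvg _ _ (L2_sqn If)) => //.
- move=> k; apply: cmeasM => //; apply: cmeas_real; exact: measurable_indic.
- move=> x; apply: cvg_near_cst; have := Bx x; apply: filterS => k Bkx.
  by rewrite E mem_set//= mul0r.
- by move=> k x; rewrite lee_fin E ler_piMl ?sqn_ge0// lern1 leq_b1.
Qed.

(** Pythagoras: the truncation and the remainder have disjoint supports. *)
Lemma N2_indic_split (B : set T) f : measurable B -> cmeas f ->
  (N2 mu f = N2 mu (fun x => (\1_B x)%:C * f x)%R +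
    N2 mu (fun x => (\1_B x)%:C * f x - f x)%R)%E.
Proof.
move=> mB mf; have mi : cmeas (fun x => (\1_B x)%:C : R[i]).
  by apply: cmeas_real; exact: measurable_indic.
rewrite /N2 -ge0_integralD//.
- apply: eq_integral => x _; rewrite -EFinD; congr EFin.
  rewrite indicE; case: (x \in B) => /=.
    by rewrite mul1r subrr sqn0 addr0.
  by rewrite mul0r sub0r sqnN sqn0 add0r.
- by move=> x _; rewrite lee_fin sqn_ge0.
- by apply/measurable_EFinP; apply: measurable_sqn; exact: cmeasM.
- by move=> x _; rewrite lee_fin sqn_ge0.
- by apply/measurable_EFinP; apply: measurable_sqn; apply: cmeasB => //; exact: cmeasM.
Qed.

Lemma L1_indicM (B : set T) f : measurable B -> (mu B < +oo)%E -> L2 mu f ->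
  L1 mu (fun x => (\1_B x)%:C * f x) /\ L2 mu (fun x => (\1_B x)%:C * f x).
Proof.
move=> mB Boo If; have mf : cmeas f by case: If.
have mi : cmeas (fun x => (\1_B x)%:C : R[i]).
  by apply: cmeas_real; exact: measurable_indic.
have I2 : L2 mu (fun x => (\1_B x)%:C * f x).
  split; first exact: cmeasM.
  case: If => _; apply: le_lt_trans; apply: le_N2 => //; first exact: cmeasM.
  move=> x; rewrite sqnM sqn_real ler_piMl ?sqn_ge0//.
have Ii : L2 mu (fun x => (\1_B x)%:C).
  split => //; rewrite /N2 (_ : (\int[mu]_x _ = \int[mu]_x (\1_B x)%:E)%E).
    by rewrite integral_indic// setIT.
  apply: eq_integral => x _; rewrite sqn_real indicE.
  by case: (x \in B); rewrite /= ?expr1n ?expr0n.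
by split => //; exact: L2M_L1.
Qed.

End L2_space.

Lemma exhaustion {d} {T : measurableType d} {R : realType}
    (mu : {sigma_finite_measure set T -> \bar R}) :
  exists B : nat -> set T, [/\ forall k, measurable (B k),
    forall k, (mu (B k) < +oo)%E & forall x, \forall k \near \oo, B k x].
Proof.
have /sigma_finiteP[B [BT ndB Boo]] := sigma_finiteT mu.
exists B; split => [k|k|x]; [by have [] := Boo k|by have [] := Boo k|].
have : setT x by [].
rewrite BT => -[k _ Bkx]; exists k => // j /= kj.
by move: x Bkx; exact/subsetPset/ndB.
Qed.

(** * Translation of [cLnorm] and [cLfun] into integrals and squared norms *)

Section L2_bridge.
Context {R : realType} {n : nat}.
Local Notation m := (lebesgue R n).
Implicit Types f g : n.-tuple R -> R[i].

Let Lnorm2E f : cLnorm 2%:E f = (N2 m f `^ 2^-1)%E.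
Proof.
rewrite /cLnorm unlock; congr (_ `^ _)%E; apply: eq_integral => x _.
by rewrite abse_EFin ger0_norm ?normc_ge0// poweR_EFin powR_mulrn ?normc_ge0// normc_sqr.
Qed.

Lemma cLfun2P f : cLfun 2%:E f <-> L2 m f.
Proof.
rewrite /cLfun Lnorm2E; split => -[mf foo]; split => //.
  by apply: (@lty_poweRy _ _ 2^-1).
exact: poweR_lty.
Qed.

Lemma cLfun1P f : cLfun 1%:E f <-> L1 m f.
Proof.
have E : cLnorm 1%:E f = (\int[m]_x (normc (f x))%:E)%E.
  rewrite /cLnorm Lnorm1; apply: eq_integral => x _.
  by rewrite /= ger0_norm ?normc_ge0.
split => [[mf]|If]; first by rewrite E => foo; apply/L1P.
by split; [exact: (L1_cmeas If)|rewrite E; exact: L1_ltoo].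
Qed.

Lemma cLnorm2E f : L2 m f -> cLnorm 2%:E f = (Num.sqrt (n2 m f))%:E.
Proof.
move=> If; rewrite Lnorm2E -(EFin_n2 If) poweR_EFin powR12_sqrt//.
exact: n2_ge0.
Qed.

Lemma cLnorm2_cvg0 (u : nat -> n.-tuple R -> R[i]) : (forall k, L2 m (u k)) ->
  cLnorm 2%:E (u k) @[k --> \oo] --> 0%E <-> n2 m (u k) @[k --> \oo] --> (0 : R).
Proof.
move=> Iu; under eq_fun do rewrite cLnorm2E//; split => [u0|u0].
  have s0 : Num.sqrt (n2 m (u k)) @[k --> \oo] --> (0 : R) by exact: fine_cvg u0.
  rewrite (_ : (fun k => n2 m (u k)) =
    (fun k => Num.sqrt (n2 m (u k)) * Num.sqrt (n2 m (u k)))).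
    by rewrite -[X in _ --> X](mul0r (0 : R)); apply: cvgM; exact: s0.
  by apply/funext => k; rewrite -expr2 sqr_sqrtr// n2_ge0.
apply: cvg_EFin; first exact: nearW.
rewrite -[X in _ --> X]sqrtr0.
by apply: (cvg_comp _ _ u0); exact: sqrt_continuous.
Qed.

End L2_bridge.

(** * The Plancherel transform on L^2 and its surjectivity *)

Section plancherel_transform.
Context {R : realType} {n : nat}.
Local Notation m := (lebesgue R n).
Implicit Types f g h u v : n.-tuple R -> R[i].

Let c : R := (2 * pi) ^+ n.

Let c_gt0 : 0 < c.
Proof. by rewrite exprn_gt0// mulr_gt0// pi_gt0. Qed.

Lemma dotC (x y : n.-tuple R) : dot x y = dot y x.
Proof. by apply: eq_bigr => i _; rewrite mulrC. Qed.

Local Notation F := (ft m (@dot R n)).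

Lemma fourier1E : @fourier1 R n = F.
Proof.
apply/funext => f; apply/funext => xi; apply: (@eq_cint _ _ _ m) => x.
by rewrite dotC.
Qed.

Lemma cmeas_fourier h : cmeas h -> cmeas (F h).
Proof. by move=> mh; exact: (@cmeas_ft _ _ _ _ _ m _ (@measurable_dot R n) h mh). Qed.

Lemma N2_fourier h : L1 m h -> L2 m h -> N2 m (F h) = (c%:E * N2 m h)%E.
Proof. by move=> I1 I2; exact: (plancherel_lebesgue I1 I2). Qed.

Lemma L2_fourier h : L1 m h -> L2 m h -> L2 m (F h).
Proof.
move=> I1 I2; split; first exact/cmeas_fourier/L1_cmeas/I1.
by rewrite N2_fourier// lte_mul_pinfty ?lee_fin ?ltW//; case: I2.
Qed.

Lemma n2_fourier h : L1 m h -> L2 m h -> n2 m (F h) = c * n2 m h.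
Proof. by move=> I1 I2; rewrite /n2 N2_fourier// fineM ?N2_fin. Qed.

Lemma n2_fourierB g h : L1 m g -> L2 m g -> L1 m h -> L2 m h ->
  n2 m (fun x => F g x - F h x) = c * n2 m (fun x => g x - h x).
Proof.
move=> Ig1 Ig2 Ih1 Ih2; rewrite -n2_fourier; [|exact: L1B|exact: L2B].
by rewrite ftB//; exact: measurable_dot.
Qed.

Definition transform f g := [/\ L2 m f, L2 m g &
  exists h : nat -> n.-tuple R -> R[i], [/\ forall k, L1 m (h k) /\ L2 m (h k),
    n2 m (fun x => h k x - f x) @[k --> \oo] --> (0 : R) &
    n2 m (fun x => F (h k) x - g x) @[k --> \oo] --> (0 : R)]].

Lemma is_fourierP f g : is_fourier f g <-> transform f g.
Proof.
split=> [[/cLfun2P If /cLfun2P Ig [h [Ih hf hg]]]|[If Ig [h [Ih hf hg]]]].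
  have {}Ih k : L1 m (h k) /\ L2 m (h k).
    by have [/cLfun1P ? /cLfun2P ?] := Ih k.
  split => //; exists h; split => //.
    by apply/cLnorm2_cvg0 => // k; apply: L2B => //; case: (Ih k).
  move: hg; rewrite fourier1E => hg.
  apply/cLnorm2_cvg0 => // k; apply: L2B => //.
  by have [? ?] := Ih k; exact: L2_fourier.
split; [exact/cLfun2P|exact/cLfun2P|exists h; split].
- by move=> k; have [? ?] := Ih k; split; [exact/cLfun1P|exact/cLfun2P].
- by apply/cLnorm2_cvg0 => // k; apply: L2B => //; case: (Ih k).
- rewrite fourier1E; apply/cLnorm2_cvg0 => // k; apply: L2B => //.
  by have [? ?] := Ih k; exact: L2_fourier.
Qed.

Let ler_limn_affine (a b p q : nat -> R) (z w : R) : a k @[k --> \oo] --> (0 : R) ->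
  b k @[k --> \oo] --> (0 : R) -> p k @[k --> \oo] --> (0 : R) ->
  q k @[k --> \oo] --> (0 : R) ->
  forall A B C D : R, (forall k, z <= A * a k + B * b k + C * p k + D * q k + w) -> z <= w.
Proof.
move=> a0 b0 p0 q0 A B C D h.
rewrite (_ : w = A * 0 + B * 0 + C * 0 + D * 0 + w); last by rewrite !mulr0 !add0r.
apply: (@ler_limn _ (fun=> z) _ _ _ _ _ h); first exact: cvg_cst.
apply: cvgD; last exact: cvg_cst.
apply: cvgD; last by apply: cvgM => //; exact: cvg_cst.
apply: cvgD; last by apply: cvgM => //; exact: cvg_cst.
by apply: cvgD; (apply: cvgM => //; exact: cvg_cst).
Qed.

Let quasi_triangle f f' h h' : L2 m f -> L2 m f' -> L2 m h -> L2 m h' ->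
  n2 m (fun x => f x - f' x) <= 2 * n2 m (fun x => h x - f x) +
    4 * n2 m (fun x => h' x - f' x) + 4 * n2 m (fun x => h x - h' x).
Proof.
move=> If If' Ih Ih'; apply: (le_trans (n2B_le If Ih If')).
have := n2B_le Ih Ih' If'; rewrite (n2_distC _ f h).
set p := n2 _ _; set q := n2 _ _; set r := n2 _ _; set s := n2 _ _.
by move: p q r s => p q r s; clear; lra.
Qed.

Let quasi_triangle_sym f f' h h' : L2 m f -> L2 m f' -> L2 m h -> L2 m h' ->
  n2 m (fun x => h x - h' x) <= 2 * n2 m (fun x => h x - f x) +
    4 * n2 m (fun x => h' x - f' x) + 4 * n2 m (fun x => f x - f' x).
Proof.
move=> If If' Ih Ih'; rewrite (n2_distC _ h f) (n2_distC _ h' f').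
exact: quasi_triangle.
Qed.

Let transform_bound_aux (K a b p q z w x y : R) : 0 < K ->
  z <= 2 * a + 4 * b + 4 * x -> x = K * y -> y <= 2 * p + 4 * q + 4 * w ->
  z <= 2 * a + 4 * b + (8 * K) * p + (16 * K) * q + 16 * K * w.
Proof.
clear; move=> K0 + xE yp; rewrite xE => zab; apply: (le_trans zab); rewrite -!addrA !lerD2l.
have : 4 * (K * y) <= 4 * (K * (2 * p + 4 * q + 4 * w)).
  by rewrite ler_pM2l// ler_pM2l.
by move=> /le_trans; apply; rewrite le_eqVlt; apply/orP; left; apply/eqP; ring.
Qed.

(** The comparison passes from f to its approximants, through Plancherel to their transforms, and on
    to g. Each of the two quasi-triangle inequalities puts a 4 before its middle term, whence 16. *)
Lemma transform_le f f' g g' : transform f g -> transform f' g' ->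
  n2 m (fun x => f x - f' x) <= 16 * c^-1 * n2 m (fun x => g x - g' x).
Proof.
move=> [If Ig [h [Ih hf hg]]] [If' Ig' [h' [Ih' hf' hg']]].
apply: (ler_limn_affine hf hf' hg hg' (A := 2) (B := 4) (C := 8 * c^-1) (D := 16 * c^-1)) => k /=.
have [I1 I2] := Ih k; have [I1' I2'] := Ih' k.
apply: transform_bound_aux _ (quasi_triangle If If' I2 I2') _
  (quasi_triangle_sym Ig Ig' (L2_fourier I1 I2) (L2_fourier I1' I2')).
  by rewrite invr_gt0.
by rewrite n2_fourierB// mulKf// gt_eqF.
Qed.

(** A diagonal choice: for each j, one function of L^1 and L^2 within 1 / (j + 1) of f_j whose
    transform is equally close to g_j. *)
Lemma transform_closed (f_ g_ : nat -> n.-tuple R -> R[i]) f g :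
  (forall j, transform (f_ j) (g_ j)) -> L2 m f -> L2 m g ->
  n2 m (fun x => f_ j x - f x) @[j --> \oo] --> (0 : R) ->
  n2 m (fun x => g_ j x - g x) @[j --> \oo] --> (0 : R) ->
  transform f g.
Proof.
move=> fg If Ig ff gg; split => //.
have ex j : exists h, [/\ L1 m h, L2 m h, n2 m (fun x => h x - f_ j x) <= j.+1%:R^-1 &
    n2 m (fun x => F h x - g_ j x) <= j.+1%:R^-1].
  have [Ifj Igj [h [Ih hf hg]]] := fg j.
  have j0 : 0 < (j.+1%:R^-1 : R) by rewrite invr_gt0.
  have /cvgrPdist_le/(_ _ j0) := hf; have /cvgrPdist_le/(_ _ j0) := hg.
  move=> hg' hf'; have [k /= [hfk hgk]] : exists k,
      `|0 - n2 m (fun x => h k x - f_ j x)| <= j.+1%:R^-1 /\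
      `|0 - n2 m (fun x => F (h k) x - g_ j x)| <= j.+1%:R^-1.
    by have [k []] := filter_ex (filterI hf' hg'); exists k.
  exists (h k); have [? ?] := Ih k; split => //.
    by move: hfk; rewrite sub0r normrN ger0_norm ?n2_ge0.
  by move: hgk; rewrite sub0r normrN ger0_norm ?n2_ge0.
have [h hP] := choice ex; exists h; split.
- by move=> k; have [] := hP k.
- apply: (@squeeze_cvgr _ _ _ _ (cst 0)
    (fun j => 2 * harmonic j + 2 * n2 m (fun x => f_ j x - f x))).
  + apply: nearW => j; rewrite n2_ge0 /=; have [_ I2 hf _] := hP j.
    have [Ifj _ _] := fg j; apply: (le_trans (n2B_le I2 Ifj If)).
    by rewrite lerD2r ler_wpM2l.
  + exact: cvg_cst.
  + rewrite -[X in _ --> X](_ : 2 * 0 + 2 * 0 = 0); last by rewrite !mulr0 addr0.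
    by apply: cvgD; apply: cvgM => //; [exact: cvg_cst|exact: cvg_harmonic|exact: cvg_cst].
- apply: (@squeeze_cvgr _ _ _ _ (cst 0)
    (fun j => 2 * harmonic j + 2 * n2 m (fun x => g_ j x - g x))).
  + apply: nearW => j; rewrite n2_ge0 /=; have [I1 I2 _ hg] := hP j.
    have [_ Igj _] := fg j; apply: (le_trans (n2B_le (L2_fourier I1 I2) Igj Ig)).
    by rewrite lerD2r ler_wpM2l.
  + exact: cvg_cst.
  + rewrite -[X in _ --> X](_ : 2 * 0 + 2 * 0 = 0); last by rewrite !mulr0 addr0.
    by apply: cvgD; apply: cvgM => //; [exact: cvg_cst|exact: cvg_harmonic|exact: cvg_cst].
Qed.

(** The rate is the one asked for by [L2_complete]; [phi] merely selects indices and may fail to be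
    increasing. *)
Lemma rapid_subsequence (a : nat -> R) : a k @[k --> \oo] --> (0 : R) ->
  exists phi : nat -> nat, forall i, a (phi i) <= 8^-1 ^+ i.
Proof.
move=> a0; have ex i : exists k, a k <= 8^-1 ^+ i.
  have e0 : 0 < 8^-1 ^+ i :> R by rewrite exprn_gt0.
  have /cvgrPdist_le/(_ _ e0) h := a0; have [k ak] := filter_ex h.
  by exists k; apply: le_trans ak; rewrite sub0r normrN ler_norm.
by have [phi ?] := choice ex; exists phi.
Qed.

Let cvg_geometric8 (u : nat -> R) : (forall i, 0 <= u i) ->
  (forall i, u i <= 8^-1 ^+ i) -> u i @[i --> \oo] --> (0 : R).
Proof.
move=> u0 u8; apply: (@squeeze_cvgr _ _ _ _ (cst 0) (geometric 1 8^-1)).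
- by apply: nearW => i; rewrite u0 /= mul1r u8.
- exact: cvg_cst.
- apply: cvg_geometric; rewrite ger0_norm ?invr_ge0//.
  by rewrite invf_lt1// ltr1n.
Qed.

Let n2_increment (v : nat -> n.-tuple R -> R[i]) w : (forall i, L2 m (v i)) -> L2 m w ->
  (forall i, n2 m (fun x => v i x - w x) <= 8^-1 ^+ i) ->
  forall i, n2 m (fun x => v i.+1 x - v i x) <= 4 / 8 ^+ i.
Proof.
move=> Iv Iw vw i; apply: (le_trans (n2B_le (Iv i.+1) Iw (Iv i))).
rewrite [X in _ + 2 * X]n2_distC -exprVn [leRHS](_ : _ = 2 * 8^-1 ^+ i + 2 * 8^-1 ^+ i); last first.
  by rewrite -mulrDl -natrD.
apply: lerD; rewrite ler_wpM2l//; apply: (le_trans (vw _)).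
rewrite exprS ler_piMl ?exprn_ge0 ?invr_ge0//.
by rewrite invf_le1 ?ler1n.
Qed.

(** Truncations of f to sets of finite measure lie in L^1 and L^2, and Plancherel carries their
    Cauchy rate over to their transforms, whose limit is the transform of f. *)
Lemma transform_exists f : L2 m f -> exists g, transform f g.
Proof.
move=> If; have [B [mB Boo Bx]] := exhaustion m.
have [phi hphi] := rapid_subsequence (L2_dom_cvg mB Bx If).
pose h i x := (\1_(B (phi i)) x)%:C * f x.
have Ih i : L1 m (h i) /\ L2 m (h i) by exact: (L1_indicM (mB _) (Boo _) If).
have Ih2 i : L2 m (h i) by case: (Ih i).
have IF i : L2 m (F (h i)) by have [? ?] := Ih i; exact: L2_fourier.
have hinc := n2_increment Ih2 If hphi.
have Finc i : n2 m (fun x => F (h i.+1) x - F (h i) x) <= c * 4 / 8 ^+ i.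
  have [? ?] := Ih i; have [? ?] := Ih i.+1; rewrite n2_fourierB// -mulrA.
  by rewrite ler_wpM2l// ltW.
have [g Ig Fg] := L2_complete IF Finc.
exists g; split => //; exists h; split => //.
by apply: cvg_geometric8 => // i; exact: n2_ge0.
Qed.

(* The inverse transform is [u := c^-1 *: conj (F (conj g))]. With [w := 1_B u],
   expanding [|F w - g|^2] and computing the cross term by the multiplication
   formula gives [|F w - g|^2 = c * |w - u|^2]. *)
Lemma inverse_transform_L1 g : L1 m g -> L2 m g -> exists u, transform u g.
Proof.
move=> I1 I2; have J1 := L1J I1; have J2 := L2J I2.
pose u x := c^-1%:C * (F (fun y => (g y)^*%C) x)^*%C.
have IFJ := L2_fourier J1 J2.
have Iu : L2 m u by apply: L2Zl; exact: L2J.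
have [B [mB Boo Bx]] := exhaustion m.
pose w k x := (\1_(B k) x)%:C * u x.
have Iw k : L1 m (w k) /\ L2 m (w k) by exact: (L1_indicM (mB _) (Boo _) Iu).
have wu : n2 m (fun x => w k x - u x) @[k --> \oo] --> (0 : R) by exact: L2_dom_cvg.
exists u; split => //; exists w; split => //.
have n2u : n2 m u = c^-1 * n2 m g.
  rewrite /n2 /u N2Zl; last by case: (L2J IFJ).
  rewrite (@eq_N2 _ _ _ m _ (F (fun y => (g y)^*%C))); last by move=> x; rewrite sqnJ.
  rewrite N2_fourier// (@eq_N2 _ _ _ m _ g); last by move=> x; rewrite sqnJ.
  rewrite muleA -EFinM fineM ?N2_fin//= sqn_real; congr (_ * _).
  by field; rewrite gt_eqF.
have FT : ft m (fun y x => dot x y) (fun y => (g y)^*%C) = F (fun y => (g y)^*%C).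
  by apply/funext => x; apply: eq_cint => y; rewrite dotC.
have cuE x : F (fun y => (g y)^*%C) x = c%:C * (u x)^*%C.
  rewrite /u conjcMr conjcK conjc_real mulrA -rmorphM divff ?gt_eqF//.
  by rewrite mul1r.
(* On [B k] the truncation [w k] equals u, and elsewhere it vanishes, so w conj(u) = |w|^2
   everywhere. *)
have wuE k x : w k x * F (fun y => (g y)^*%C) x = c%:C * (sqn (w k x))%:C.
  rewrite cuE mulrCA; congr (_ * _); rewrite /w indicE.
  case: (x \in B k); last by rewrite !mul0r sqn0.
  by rewrite !mul1r /sqn; apply: complex_ext; rewrite ?creM ?cimM creJ cimJ /=; ring.
have key k : n2 m (fun x => F (w k) x - g x) = c * n2 m (fun x => w k x - u x).
  have [Iw1 Iw2] := Iw k; have IFw := L2_fourier Iw1 Iw2.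
  have E : cre (cint m (fun x => F (w k) x * (g x)^*%C)) = c * n2 m (w k).
    rewrite (ft_multiplication (@measurable_dot R n) Iw1 J1).
    rewrite (_ : (fun x => _) = (fun x => c%:C * (sqn (w k x))%:C)); last first.
      by apply/funext => x; rewrite FT wuE.
    have Is : L1 m (fun x => (sqn (w k x))%:C).
      by split; [exact: L2_sqn|exact: integrable0].
    by rewrite cintZl// creM mul0r subr0.
  have split := N2_indic_split m (mB k) (proj1 Iu).
  have -> : n2 m (fun x => F (w k) x - g x) = n2 m (F (w k)) -
      2 * cre (cint m (fun x => F (w k) x * (g x)^*%C)) + n2 m g.
    by rewrite [LHS]/n2 N2B_expand.
  rewrite E n2_fourier//.
  (* Since |g|^2 = c |u|^2, Pythagoras for u reduces c |w|^2 - 2 c |w|^2 + |g|^2 to c |w - u|^2. *)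
  have : n2 m u = n2 m (w k) + n2 m (fun x => w k x - u x).
    by rewrite /n2 split fineD// N2_fin//; exact: L2B.
  rewrite n2u => /(congr1 ( *%R c)); rewrite mulVKf ?gt_eqF// => ->.
  by ring.
rewrite (funext key) -(mulr0 c).
by apply: cvgM; [exact: cvg_cst|exact: wu].
Qed.

(** Truncate on the side of g: the truncations have preimages, which [transform_le] makes Cauchy at
    the same rate, and [transform_closed] identifies the limit. *)
Lemma inverse_transform_exists g : L2 m g -> exists f, transform f g.
Proof.
move=> Ig; have [B [mB Boo Bx]] := exhaustion m.
have [phi hphi] := rapid_subsequence (L2_dom_cvg mB Bx Ig).
pose h i x := (\1_(B (phi i)) x)%:C * g x.
have Ih i : L1 m (h i) /\ L2 m (h i) by exact: (L1_indicM (mB _) (Boo _) Ig).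
have Ih2 i : L2 m (h i) by case: (Ih i).
have ex i : exists u, transform u (h i).
  by have [? ?] := Ih i; exact: inverse_transform_L1.
have [u uh] := choice ex.
have Iu i : L2 m (u i) by case: (uh i).
have hinc := n2_increment Ih2 Ig hphi.
have uinc i : n2 m (fun x => u i.+1 x - u i x) <= 16 * c^-1 * 4 / 8 ^+ i.
  apply: (le_trans (transform_le (uh i.+1) (uh i))); rewrite -[leRHS]mulrA.
  by rewrite ler_wpM2l// mulr_ge0// invr_ge0 ltW.
have [f If uf] := L2_complete Iu uinc.
exists f; apply: (transform_closed uh) => //.
by apply: cvg_geometric8 => // i; exact: n2_ge0.
Qed.

End plancherel_transform.

(** * The size of the multiplier *)

Section multiplier_estimate.
Context {R : realType}.
Implicit Types (x y r : R).

Lemma sin_le_id x : 0 <= x -> `|sin x| <= x.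
Proof.
rewrite le_eqVlt => /predU1P[<-|x0]; first by rewrite sin0 normr0.
have [|c _] := @MVT R sin cos 0 x x0 (fun y _ => is_derive_sin y).
  by apply: continuous_subspaceT; exact: continuous_sin.
rewrite sin0 !subr0 => ->; rewrite normrM (gtr0_norm x0) ler_piMl//; first exact: ltW.
exact: cos_max.
Qed.

Lemma sqn_cisB1_le4 x : sqn (cis x - 1) <= 4.
Proof.
apply: (le_trans (sqnD_le _ _)); rewrite sqnN sqn_cis.
by rewrite /sqn /= expr1n expr0n /= addr0 mulr1 -natrD.
Qed.

(** The chord subtended by the angle x has length 2 |sin(x / 2)|, at most x. *)
Lemma sqn_cisB1_le x : 0 <= x -> sqn (cis x - 1) <= x ^+ 2.
Proof.
move=> x0; have x20 : 0 <= x / 2 by rewrite divr_ge0.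
have E : x = (x / 2) *+ 2 by rewrite -mulr_natr divfK.
have -> : sqn (cis x - 1) = 4 * sin (x / 2) ^+ 2.
  rewrite /sqn creB cimB /= subr0.
  have -> : (cos x - 1) ^+ 2 + sin x ^+ 2 = cos x ^+ 2 + sin x ^+ 2 + 1 - 2 * cos x by ring.
  rewrite cos2Dsin2 [in cos x]E cos_mulr2n.
  have -> : sin (x / 2) ^+ 2 = 1 - cos (x / 2) ^+ 2.
    by apply: (addrI (cos (x / 2) ^+ 2)); rewrite cos2Dsin2 addrC subrK.
  by ring.
have := sin_le_id x20; rewrite -(ler_pXn2r (n := 2)) ?nnegrE//.
rewrite real_normK ?num_real// => h.
rewrite (le_trans (ler_wpM2l _ h))// le_eqVlt; apply/orP; left; apply/eqP.
by field.
Qed.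

Variables (s : R) (gamma : R -> R).
Hypotheses (s_gt0 : 0 < s) (s_le1 : s <= 1).
Hypothesis gamma_gt0 : forall r : R, 0 < r -> 0 < gamma r.
Hypothesis gamma_smooth : smooth_pos gamma.
Hypothesis gamma_div_incr : increasing_pos (fun r : R => gamma r / r).

(** Since gamma(r) / r is nondecreasing, gamma lies below the line gamma(1) r on (0, 1] and above it
    on [1, oo). The points [a] and [b] are 1 and the preimage of y under that line, in increasing
    order; they bracket y for the intermediate value theorem. *)
Lemma gamma_surjective y : 0 < y -> exists2 r, 0 < r & gamma r = y.
Proof.
move=> y0; have g1 : 0 < gamma 1 by exact: gamma_gt0.
have v0 : 0 < y / gamma 1 by rewrite divr_gt0.
pose a := Num.min 1 (y / gamma 1); pose b := Num.max 1 (y / gamma 1).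
have a0 : 0 < a by rewrite lt_min ltr01.
have a1 : a <= 1 by rewrite ge_min lexx.
have b1 : 1 <= b by rewrite le_max lexx.
have b0 : 0 < b by exact: lt_le_trans b1.
have ga : gamma a <= y.
  have := gamma_div_incr a0 a1; rewrite divr1 ler_pdivrMr// => /le_trans; apply.
  rewrite mulrC -ler_pdivlMr//; by rewrite ge_min lexx orbT.
have gb : y <= gamma b.
  have := gamma_div_incr ltr01 b1; rewrite divr1 ler_pdivlMr//; apply: le_trans.
  by rewrite mulrC -ler_pdivrMr// le_max lexx orbT.
have ab : a <= b by exact: le_trans b1.
have [||c cab <-] := @IVT R gamma a b y ab.
- apply: derivable_within_continuous => x; rewrite in_itv /= => /andP[ax _].
  by exact: (@gamma_smooth 0%N x (lt_le_trans a0 ax)).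
- by rewrite ge_min ga /= le_max gb orbT.
exists c => //; move: cab; rewrite in_itv /= => /andP[ac _].
exact: lt_le_trans ac.
Qed.

(** Surjectivity makes the partial inverse a right inverse with positive values, the form in which
    gamma^-1 enters the multiplier estimate. *)
Lemma inverse_posP y : 0 < y ->
  0 < inverse_pos gamma y /\ gamma (inverse_pos gamma y) = y.
Proof.
move=> y0.
have surj : set_surj [set x : R | 0 < x] [set x : R | 0 < x] gamma.
  by move=> z /= /gamma_surjective[r r0 <-]; exists r.
split; last by rewrite /inverse_pos pinvK// inE; exact: surj.
by apply: (surjpinv_image_sub (dflt := fun=> 0) surj); exists y.
Qed.

Lemma multiplier_le (t r : R) : 0 < t -> 0 < r ->
  sqn (cis (t * gamma r) - 1) <= (4 + gamma 1 ^+ 2) *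
    (1 / inverse_pos gamma (gamma 1 / t) `^ (2 * s)) * (1 + r ^+ 2) `^ s.
Proof.
move=> t0 r0; have g1 : 0 < gamma 1 by exact: gamma_gt0.
have [rho0 grho] := inverse_posP (divr_gt0 g1 t0).
set rho := inverse_pos _ _ in rho0 grho *.
pose a := r / rho; have a0 : 0 < a by rewrite divr_gt0.
have s20 : 0 <= 2 * s by rewrite mulr_ge0// ltW.
have s2 : 2 * s <= 2 by rewrite ler_piMr.
have K0 : 0 <= 4 + gamma 1 ^+ 2 by rewrite addr_ge0// sqr_ge0.
(* The power of rho is the term of the given series; the weight r^(2s) is enlarged to the Sobolev
   weight. *)
have aE : a `^ (2 * s) <= 1 / rho `^ (2 * s) * (1 + r ^+ 2) `^ s.
  rewrite /a powRM ?invr_ge0 ?(ltW r0) ?(ltW rho0)//.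
  rewrite -(powR_inv1 (ltW rho0)) -powRrM mulN1r powRN mulrC div1r.
  rewrite ler_wpM2l ?invr_ge0 ?powR_ge0// powRrM powR_mulrn ?(ltW r0)//.
  by apply: ge0_ler_powR; rewrite ?nnegrE ?addr_ge0 ?sqr_ge0 ?lerDr ?(ltW s_gt0)//.
apply: (@le_trans _ _ ((4 + gamma 1 ^+ 2) * a `^ (2 * s))); last first.
  by rewrite -mulrA ler_wpM2l.
(* Up to rho, the factor gamma(1)^2 is used together with a^2 <= a^(2s), as a <= 1 and 2s <= 2;
   beyond rho, the factor 4 together with 1 <= a^(2s). The constant is the sum of the two
   factors. *)
have [r_rho|rho_r] := leP r rho.
  have a1 : a <= 1 by rewrite ler_pdivrMr// mul1r.
  have tg : t * gamma r <= gamma 1 * a.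
    have := gamma_div_incr r0 r_rho; rewrite grho ler_pdivrMr// => h.
    rewrite (le_trans (ler_wpM2l (ltW t0) h))// le_eqVlt; apply/orP; left; apply/eqP.
    by rewrite /a; field; rewrite !gt_eqF.
  have tg0 : 0 <= t * gamma r by rewrite mulr_ge0 ?(ltW t0)// ltW// gamma_gt0.
  rewrite (le_trans (sqn_cisB1_le tg0))//.
  apply: (@le_trans _ _ ((gamma 1 * a) ^+ 2)).
    by rewrite lerXn2r// nnegrE mulr_ge0 ?ltW.
  rewrite exprMn; apply: ler_pM; rewrite ?sqr_ge0 ?lerDr//.
  rewrite -(powR_mulrn 2 (ltW a0)); by apply: ger_powR; rewrite ?a0.
rewrite (le_trans (sqn_cisB1_le4 _))//.
have a1 : 1 <= a by rewrite ler_pdivlMr// mul1r ltW.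
apply: (@le_trans _ _ ((4 + gamma 1 ^+ 2) * 1)).
  by rewrite mulr1 lerDl sqr_ge0.
rewrite ler_wpM2l// -[leLHS](powRr0 a).
by apply: ler_powR.
Qed.

End multiplier_estimate.

(** * Almost everywhere convergence and radial multipliers *)

Lemma ae_cvg_of_summable {d} {T : measurableType d} {R : realType}
    (mu : {measure set T -> \bar R}) (u : nat -> T -> R[i]) (f : T -> R[i]) :
  (forall k, cmeas (u k)) -> cmeas f ->
  (\sum_(0 <= k <oo) N2 mu (fun x => (u k x - f x)%R) < +oo)%E ->
  {ae mu, forall x, sqn (u k x - f x) @[k --> \oo] --> (0 : R)}.
Proof.
move=> mu_ mf Soo; pose D k x := (sqn (u k x - f x))%:E.
have D0 k x : (0 <= D k x)%E by rewrite lee_fin sqn_ge0.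
have mD k : measurable_fun setT (D k).
  by apply/measurable_EFinP; apply: measurable_sqn; exact: cmeasB.
have mS : measurable_fun setT (fun x => \sum_(k <oo) D k x)%E.
  by apply: ge0_emeasurable_sum => // k x _ _; exact: D0.
have S0 x : (0 <= \sum_(k <oo) D k x)%E by apply: nneseries_ge0 => k _ _.
have : mu.-integrable setT (fun x => \sum_(k <oo) D k x)%E.
  apply/integrableP; split => //; under eq_integral do rewrite gee0_abs//.
  by rewrite integral_nneseries.
move=> /(integrable_ae measurableT); apply: filterS => x /(_ I) Sx.
apply: cvg_series_cvg_0.
apply: nondecreasing_is_cvgn.
  by apply: nondecreasing_series => k _ _; exact: sqn_ge0.
exists (fine (\sum_(k <oo) D k x)%E) => _ [k _ <-].
rewrite -lee_fin fineK// /series /= -sumEFin.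
exact: (@nneseries_lim_ge R (D^~ x) predT 0 k (fun k _ _ => D0 k x)).
Qed.

Section radial_multiplier.
Context {R : realType}.

Lemma enorm_ge0 n (x : n.-tuple R) : 0 <= enorm x.
Proof. exact: sqrtr_ge0. Qed.

Lemma measurable_enorm n : measurable_fun setT (@enorm R n).
Proof.
apply: (@measurableT_comp _ _ _ _ _ _ (@Num.sqrt R)).
  by apply: nondecreasing_measurable => // a b; exact: ler_wsqrtr.
apply: measurable_sum => i.
by apply: measurable_funM; exact: measurable_tnth.
Qed.

(** The origin lies in the hyperplane where the first coordinate vanishes, a null set. In dimension
    0 the origin would carry the whole mass. *)
Lemma ae_enorm_gt0 n : (1 <= n)%N -> {ae lebesgue R n, forall x, 0 < enorm x}.
Proof.
case: n => // n _; pose N := [set x : n.+1.-tuple R | thead x = 0].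
have mN : measurable N.
  rewrite -[N]setTI.
  exact: (@measurable_tnth _ R n.+1 ord0 measurableT _ (measurable_set1 (0 : R))).
exists N; split => //.
  have -> : lebesgue R n.+1 N =
      product_measure1 lebesgue_measure (lebesgue R n) ([set 0] `*` setT).
    rewrite /= /lebesgue_cons /pushforward; congr product_measure1.
    apply/seteqP; split => -[a b] /=; rewrite /N /cons_prod /= theadE.
      by move=> ->.
    by case.
  by rewrite product_measure1E//= lebesgue_measure_set1 mul0e.
move=> x /= /negP; rewrite -leNgt => x0; rewrite /N /=.
have : dot x x <= 0.
  by move: x0; rewrite /enorm -{1}sqrtr0 ler_sqrt.
rewrite /dot big_ord_recl => h; apply/eqP; rewrite -sqrf_eq0 eq_le sqr_ge0 andbT.
apply: le_trans h; rewrite expr2 lerDl sumr_ge0// => i _.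
by rewrite -expr2 sqr_ge0.
Qed.

(** gamma is controlled only on (0, oo). There it agrees with the nondecreasing [g'], extended by 0
    to the line; the arbitrary value at 0 enters as a constant branch. *)
Lemma measurable_radial n (gamma : R -> R) :
  (forall r : R, 0 < r -> 0 < gamma r) -> increasing_pos gamma ->
  measurable_fun setT (fun x : n.-tuple R => gamma (enorm x)).
Proof.
move=> g0 gi; pose g' (r : R) := if 0 < r then gamma r else 0.
have mg' : measurable_fun setT g'.
  apply: nondecreasing_measurable => // a b ab; rewrite /g'.
  case: ltP => a0; last by case: ltP => // b0; exact/ltW/g0.
  by rewrite (lt_le_trans a0 ab) gi.
have -> : (fun x : n.-tuple R => gamma (enorm x)) =
    (fun x : n.-tuple R => if 0 < enorm x then g' (enorm x) else gamma 0).
  apply/funext => x; rewrite /g'; case: ltP => // x0.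
  by congr gamma; apply/eqP; rewrite eq_le x0 enorm_ge0.
apply: measurable_fun_ifT.
- by apply: measurable_fun_ltr; [exact: measurable_cst|exact: measurable_enorm].
- exact: (measurableT_comp mg' (@measurable_enorm n)).
- exact: measurable_cst.
Qed.

End radial_multiplier.

Theorem theorem1p5 (R : realType) (n : nat) (s : R) (gamma : R -> R)
  (t : nat -> R) (f : n.-tuple R -> R[i])
  (n_ge1 : (1 <= n)%N)
  (s_gt0 : 0 < s) (s_le1 : s <= 1)
  (gamma_gt0 : forall r : R, 0 < r -> 0 < gamma r)
  (gamma_smooth : smooth_pos gamma)
  (gamma_incr : increasing_pos gamma)
  (gamma_div_smooth : smooth_pos (fun r : R => gamma r / r))
  (gamma_div_incr : increasing_pos (fun r : R => gamma r / r))
  (t_gt0 : forall k : nat, 0 < t k)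
  (t_cvg0 : t k @[k --> \oo] --> (0 : R))
  (t_sum : (\sum_(0 <= k <oo)
      (1 / inverse_pos gamma (gamma 1 / t k) `^ (2 * s))%:E < +oo)%E)
  (f_sobolev : sobolev s f) :
  {ae lebesgue R n, forall x : n.-tuple R,
    (((2 * pi) ^- n)%:C * S_op (t k) gamma f x : R[i]^o) @[k --> \oo]
      --> (f x : R[i]^o)}.
Proof.
have [/cLfun2P If] := f_sobolev; set fh := fourier f => fh_sobolev.
have ff : transform f fh.
  (* Existence of a transform ensures that [xget] returns an element of the set; the same is done
     below for [inverse_fourier]. *)
  apply/is_fourierP; apply: (xgetPex (fun=> 0)).
  by have [g /is_fourierP ?] := transform_exists If; exists g.
have [_ Ifh _] := ff; have [mfh _] := Ifh.
pose g k xi := cis (t k * gamma (enorm xi)) * fh xi.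
have mcis k : cmeas (fun xi : n.-tuple R => cis (t k * gamma (enorm xi))).
  apply: cmeas_cis; apply: measurable_funM; first exact: measurable_cst.
  exact: measurable_radial.
have Ig k : L2 (lebesgue R n) (g k).
  split; first exact: cmeasM.
  rewrite (@eq_N2 _ _ _ _ _ fh); first by case: Ifh.
  by move=> x; rewrite sqnM sqn_cis mul1r.
pose u k := inverse_fourier (g k).
have ug k : transform (u k) (g k).
  apply/is_fourierP; apply: (xgetPex (fun=> 0) (P := [set f | is_fourier f (g k)])).
  by have [w /is_fourierP ?] := inverse_transform_exists (Ig k); exists w.
have Iu k : L2 (lebesgue R n) (u k) by case: (ug k).
pose H := (\int[lebesgue R n]_xi ((1 + enorm xi ^+ 2) `^ s * sqn (fh xi))%:E)%E.
have Hoo : (H < +oo)%E.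
  by rewrite /H; under eq_integral do rewrite -normc_sqr.
have H0 : (0 <= H)%E.
  by apply: integral_ge0 => x _; rewrite lee_fin mulr_ge0 ?sqn_ge0 ?powR_ge0.
have HE : H = (fine H)%:E by rewrite fineK// ge0_fin_numE.
pose a k := 1 / inverse_pos gamma (gamma 1 / t k) `^ (2 * s).
have a0 k : 0 <= a k by rewrite divr_ge0 ?powR_ge0.
pose K := 4 + gamma 1 ^+ 2.
have K0 : 0 <= K by rewrite addr_ge0// sqr_ge0.
have mH : measurable_fun setT (fun xi : n.-tuple R => (1 + enorm xi ^+ 2) `^ s * sqn (fh xi)).
  apply: measurable_funM; last exact: measurable_sqn.
  apply: (@measurableT_comp _ _ _ _ _ _ (@powR R ^~ s)); first exact: measurable_powR.
  apply: measurable_funD; first exact: measurable_cst.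
  by apply: measurable_funX; exact: measurable_enorm.
have N2g k : (N2 (lebesgue R n) (fun x => (g k x - fh x)%R) <= (K * a k)%:E * H)%E.
  rewrite /H -ge0_integralZl//; last 3 first.
  - exact/measurable_EFinP.
  - by move=> x _; rewrite lee_fin mulr_ge0 ?sqn_ge0 ?powR_ge0.
  - by rewrite lee_fin mulr_ge0.
  apply: ae_ge0_le_integral => //.
  - by move=> x _; rewrite lee_fin sqn_ge0.
  - by apply/measurable_EFinP; apply: measurable_sqn; apply: cmeasB => //; exact: cmeasM.
  - by move=> x _; apply: mule_ge0; rewrite lee_fin mulr_ge0 ?sqn_ge0 ?powR_ge0.
  - apply: emeasurable_funM; first exact: measurable_cst.
    exact/measurable_EFinP.
  (* The multiplier estimate needs a positive radius, so it is applied off the origin, hence almost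
     everywhere. *)
  apply: filterS (ae_enorm_gt0 n_ge1) => x x0 _; rewrite -EFinM lee_fin.
  rewrite /g -{2}(mul1r (fh x)) -mulrBl sqnM mulrA ler_wpM2r ?sqn_ge0//.
  exact: multiplier_le.
have aeu : {ae lebesgue R n, forall x, sqn (u k x - f x) @[k --> \oo] --> (0 : R)}.
  apply: ae_cvg_of_summable; [by move=> k; case: (Iu k)|by case: If|].
  (* The first factors come from [transform_le]; K times the Sobolev integral comes from the
     multiplier estimate. *)
  pose L := 16 * ((2 * pi) ^+ n)^-1 * (K * fine H).
  apply: (@le_lt_trans _ _ (\sum_(0 <= k <oo) (L%:E * (a k)%:E))%E).
    apply: lee_nneseries => [k *|k _]; first exact: N2_ge0.
    rewrite -(EFin_n2 (L2B (Iu k) If)) -EFinM lee_fin.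
    apply: (le_trans (transform_le (ug k) ff)).
    rewrite /L -!mulrA ler_wpM2l// ler_wpM2l ?invr_ge0 ?exprn_ge0 ?mulr_ge0 ?pi_ge0//.
    rewrite -lee_fin (EFin_n2 (L2B (Ig k) Ifh)) (le_trans (N2g k))//.
    rewrite {1}HE -EFinM lee_fin le_eqVlt; apply/orP; left; apply/eqP.
    by rewrite /=; ring.
  rewrite nneseriesZl; last by move=> k _; rewrite lee_fin.
  rewrite lte_mul_pinfty// lee_fin /L mulr_ge0 ?mulr_ge0 ?fine_ge0//.
  by rewrite invr_ge0 exprn_ge0// mulr_ge0// pi_ge0.
apply: filterS aeu => x ux.
have E k : ((2 * pi) ^- n)%:C * S_op (t k) gamma f x = u k x.
  rewrite /S_op mulrA -rmorphM mulVf ?mul1r//.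
  by rewrite expf_neq0// mulf_neq0// gt_eqF// pi_gt0.
rewrite (funext E); apply/cvgrPdist_lt => e.
(* The radius e is itself a complex number: its positivity means a zero imaginary part and a
   positive real part, so the claim becomes an inequality between squared moduli. *)
rewrite ltcE /= => /andP[/eqP e1 e0].
have e20 : 0 < cre e ^+ 2 by rewrite exprn_gt0.
have /cvgrPdist_lt/(_ _ e20) := ux; apply: filterS => k.
rewrite sub0r normrN ger0_norm ?sqn_ge0// => uke.
have -> : e = (cre e)%:C by apply: complex_ext.
rewrite -[ltLHS]/((normc (f x - u k x))%:C) ltcR.
by rewrite -(ltr_pXn2r (n := 2)) ?nnegrE ?normc_ge0 ?ltW// normc_sqr sqn_distC.
Qed.
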